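(* Let $q$ be prime and $m\geq 3$. Define $\mathbf{Wide}^*(q,m;1)$ to be the set of $m$-tuples $(\chi_1,\ldots,\chi_m)$ of primitive Dirichlet characters modulo $q$ with $\chi_1\cdots\chi_m=1$ (the trivial character). Then, uniformly in the range $m=o(q^{1/2}\log q)$, $$\#\{(\chi_i)_i\in \mathbf{Wide}^*(q, m;1) : L(\chi_1,1/2)\cdots L(\chi_m,1/2)\neq 0 \} \gg q^{m-1}/(\log q)^m,$$ as $q\rightarrow \infty$.
   Context: $L(\chi,s)$ denotes the Dirichlet $L$-function of the Dirichlet character $\chi$. *)

(* Defs.v *)
From mathcomp Require Import all_boot all_algebra.
From mathcomp Require Import all_classical all_reals all_analysis.
From mathcomp Require Export complex.
Import GRing.Theory Num.Theory numFieldNormedType.Exports.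

Set Implicit Arguments.
Unset Strict Implicit.
Unset Printing Implicit Defensive.

Local Open Scope ring_scope.
Local Open Scope classical_set_scope.

Section Dirichlet.
Variable R : realType.
Local Notation C := (R[i]).

Definition is_dirichlet_char (q : nat) (chi : nat -> C) : Prop :=
  [/\ forall m n : nat, chi (m * n)%N = chi m * chi n,
      forall n : nat, chi (n + q)%N = chi n &
      forall n : nat, chi n = 0 <-> ~~ coprime n q].

Definition principal_char (q : nat) : nat -> C :=
  fun n => if coprime n q then 1 else 0.

(* Primitive: not induced by a character of any proper divisor modulus d,
   i.e. for each d | q, d < q, chi is not identically 1 on the integers
   n coprime to q with n = 1 mod d. *)
Definition is_primitive_char (q : nat) (chi : nat -> C) : Prop :=
  is_dirichlet_char q chi /\
  forall d : nat, (d %| q)%N -> (d < q)%N ->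
    exists n : nat, [/\ coprime n q, n = 1 %[mod d] & chi n <> 1].

Definition Lhalf_partial (chi : nat -> C) (N : nat) : C :=
  \sum_(1 <= n < N.+1) chi n / ((Num.sqrt (n%:R : R))%:C)%C.

(* L(chi,1/2): for a non-principal character the Dirichlet series converges
   (conditionally) at s = 1/2 to the value of the analytic continuation;
   we take the limit of the real and imaginary parts of the partial sums. *)
Definition Lhalf (chi : nat -> C) : C :=
  ((limn (fun N => complex.Re (Lhalf_partial chi N)))
   +i* (limn (fun N => complex.Im (Lhalf_partial chi N))))%C.

Definition Wide_star_1 (q m : nat) : set ('I_m -> nat -> C) :=
  [set t | (forall i, is_primitive_char q (t i)) /\
           forall n : nat, \prod_(i < m) t i n = principal_char q n].

End Dirichlet.

Definition card_ge {T} (R : realType) (S : set T) (x : R) : Prop :=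
  exists N : nat, x <= N%:R /\
    exists f : nat -> T, (forall k, (k < N)%N -> S (f k)) /\
      (forall k l, (k < N)%N -> (l < N)%N -> f k = f l -> k = l).

(* Main.v *)
(* For nonprincipal chi, L(1/2, chi) is the multiplicative Fourier transform of
   the regularized kernel F(x) = sum_j ((x + jq)^(-1/2) - (q + jq)^(-1/2)), and
   x^(-1/2) - q^(-1/2) <= F(x) <= x^(-1/2).  Comparing the first moment with the
   second moment over all characters by Cauchy-Schwarz, the set J of characters
   with L(1/2, chi) <> 0 has at least q / log q elements, with constant exactly 1
   because the secondary term of the second moment is negative.  This gives
   q^(m-3) / (log q)^(m-3) choices of the first m - 3 characters for every m, and
   it remains to see that each character psi is a product of three elements of J
   in >> q^2 / (log q)^3 ways.

   By Cauchy-Schwarz again it suffices to bound T = sum_{abc = psi} L(a)L(b)L(c)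
   from below and W = sum_{abc = psi} |L(a)L(b)L(c)|^2 from above.  By
   orthogonality T is about q^2 sum_x psi(x) x^(-3/2), which is >> q^2.  For W,
   split F into a part supported on x < B, with B about sqrt q / 2, and a smooth
   part, whose additive Fourier transform decays beyond B by two summations by
   parts.  Additive Parseval then bounds the kernel of |L|^2 by the multiplicative
   autocorrelation of a weight w(b) of size |b|^(-1/2) near 0.  For the short part
   of w, all pairs (b, zb) of short residues are multiples of one reduced pair
   (r, s), so the autocorrelation at z is << (log q)(rs)^(-1/2), and its cube is
   summable over z; the long part reduces to the short one by covering with cells
   of side B.  Hence W << q^2 (log q)^3. *)
Require Import Defs.
From mathcomp Require Import all_boot all_algebra.
From mathcomp Require Import all_order all_solvable finfield.
From mathcomp Require Import all_classical all_reals all_analysis.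
From mathcomp Require Import ring lra zify.
Import Order.TTheory GRing.Theory Num.Theory numFieldNormedType.Exports.
Set Implicit Arguments.
Unset Strict Implicit.
Unset Printing Implicit Defensive.
Local Open Scope ring_scope.

Local Notation normc := Normc.normc.

(** * The modulus on [R[i]] and the exponential [exp(2 pi i t)] *)

Section ComplexModulus.
Variable R : realType.
Local Notation C := (R[i]).
Implicit Types (z w : C) (t : R).

Lemma normc_ge0 z : 0 <= normc z.
Proof. by case: z => a b; exact: sqrtr_ge0. Qed.

Lemma normcN z : normc (- z) = normc z.
Proof. by case: z => a b; rewrite /normc /= !sqrrN. Qed.

Lemma normcX z n : normc (z ^+ n) = normc z ^+ n.
Proof.
by elim: n => [|n IH]; rewrite ?expr0 ?Normc.normc1 // !exprS Normc.normcM IH.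
Qed.

Lemma normc_real (a : R) : normc (a%:C)%C = `|a|.
Proof. by rewrite /normc /= expr0n /= addr0 sqrtr_sqr. Qed.

Lemma normc_sum (I : Type) (r : seq I) (P : pred I) (f : I -> C) :
  normc (\sum_(i <- r | P i) f i) <= \sum_(i <- r | P i) normc (f i).
Proof.
elim/big_ind2: _ => [|x y z w h1 h2|i _] //; first by rewrite Normc.normc0.
by apply: le_trans (le_normcD _ _) _; exact: lerD.
Qed.

Lemma normc_sqr z : normc z ^+ 2 = (complex.Re z) ^+ 2 + (complex.Im z) ^+ 2.
Proof. by case: z => a b; rewrite /normc /= sqr_sqrtr // addr_ge0 ?sqr_ge0. Qed.

Lemma normcD_sqr_le z w :
  normc (z + w) ^+ 2 <= 2 * normc z ^+ 2 + 2 * normc w ^+ 2.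
Proof.
have n0 := normc_ge0 (z + w); have h := le_normcD z w.
apply: (@le_trans _ _ ((normc z + normc w) ^+ 2)).
  by rewrite lerXn2r ?nnegrE // (le_trans n0).
by have := sqr_ge0 (normc z - normc w); rewrite !expr2; lra.
Qed.

Lemma mulcJ z : z * (z^*)%C = ((normc z ^+ 2)%:C)%C.
Proof.
rewrite normc_sqr; case: z => a b /=; apply/eqP; rewrite eq_complex /=.
by apply/andP; split; apply/eqP; ring.
Qed.

Definition cis t : C := (cos (2 * pi * t) +i* sin (2 * pi * t))%C.

Lemma cis0 : cis 0 = 1.
Proof. by rewrite /cis mulr0 cos0 sin0. Qed.

Lemma cisD t u : cis (t + u) = cis t * cis u.
Proof.
rewrite /cis mulrDr cosD sinD; apply/eqP; rewrite eq_complex /=.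
by apply/andP; split; apply/eqP; ring.
Qed.

Lemma cisX t n : cis t ^+ n = cis (t * n%:R).
Proof.
elim: n => [|n IH]; first by rewrite mulr0 cis0 expr0.
by rewrite exprSr IH -cisD -natr1 mulrDr mulr1.
Qed.

Lemma cis1 : cis 1 = 1.
Proof.
have -> : cis 1 = (cos (pi *+ 2) +i* sin (pi *+ 2))%C.
  by rewrite /cis mulr1 mulr_natl.
by rewrite cos2pi sin2pi.
Qed.

Lemma normc_cis t : normc (cis t) = 1.
Proof. by rewrite /normc /cis cos2Dsin2 sqrtr1. Qed.

Lemma normc_1Bcis_sqr t : normc (1 - cis t) ^+ 2 = 2 - 2 * cos (2 * pi * t).
Proof.
rewrite normc_sqr /= sub0r sqrrN.
have := cos2Dsin2 (2 * pi * t); set c := cos _; set s := sin _.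
by rewrite !expr2 => h; lra.
Qed.

(* Doubling [t] at most doubles the chord [|1 - cis t|]; so it suffices to
   treat [1/4 <= t <= 1/2], where the cosine is nonpositive. *)
Lemma normc_1Bcis_ge t : 0 < t -> t <= 2^-1 -> 2 * t <= normc (1 - cis t).
Proof.
move=> t0 t2.
have main n s : (2 ^+ n.+2)^-1 <= s -> s <= 2^-1 -> 2 * s <= normc (1 - cis s).
  elim: n s => [|n IH] s h1 h2.
    have cle : cos (2 * pi * s) <= 0.
      have -> : 2 * pi * s = (2 * pi * s - pi / 2) + pi / 2 by lra.
      rewrite cosDpihalf oppr_le0; apply: sin_ge0_pi.
      have p0 := @pi_gt0 R.
      have h1' : 4^-1 <= s by move: h1; rewrite (_ : 2 ^+ 2 = 4) //; ring.
      apply/andP; split; nra.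
    have h := normc_1Bcis_sqr s.
    have g := normc_ge0 (1 - cis s).
    set v := normc _ in h g *; nra.
  have [h3|h3] := leP (4^-1) s.
    apply: (IH) => //; apply: le_trans h3.
    rewrite lef_pV2 ?posrE ?exprn_gt0 // !exprS.
    have : 1 <= (2:R) ^+ n by apply: exprn_ege1; lra.
    lra.
  have h4 : 2 * (2 * s) <= normc (1 - cis (2 * s)).
    apply: IH; last by lra.
    move: h1; rewrite [in X in X -> _]exprS invfM => h1; lra.
  have e : 1 - cis (2 * s) = (1 - cis s) * (1 + cis s).
    by rewrite (_ : 2 * s = s + s); [rewrite cisD; ring | ring].
  rewrite e Normc.normcM in h4.
  have h5 : normc (1 + cis s) <= 2.
    apply: le_trans (le_normcD _ _) _.
    by rewrite Normc.normc1 normc_cis; lra.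
  have := ler_wpM2l (normc_ge0 (1 - cis s)) h5; lra.
have [n hn] : exists n, (2 ^+ n.+2)^-1 <= t.
  exists (Num.bound t^-1); rewrite -[leRHS]invrK lef_pV2 ?posrE ?invr_gt0 ?exprn_gt0 //.
  apply: ltW; apply: lt_le_trans (archi_boundP _) _; first by rewrite invr_ge0 ltW.
  rewrite -natrX ler_nat; apply: leq_trans (ltnW (ltn_expl _ (ltnSn 1))) _.
  by rewrite leq_exp2l // -addn2 leq_addr.
exact: main hn t2.
Qed.

End ComplexModulus.

(** * Multiplicative characters of a prime field and their orthogonality *)

Section Characters.
Variables (R : realType) (q : nat) (q_pr : prime q).
Local Notation C := (R[i]).
Local Notation F := 'F_q.
Local Notation I := 'I_(q.-2.+1).

(** Character indices live in ['I_(q.-2.+1)] because the visible successor supplies the additive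
    group of integers mod [q - 1]; adding indices then multiplies characters. *)
Lemma pred2K : q.-2.+1 = q.-1.
Proof. by case: q q_pr => [|[|n]]. Qed.

Lemma Fp_expf_pred (x : F) : x != 0 -> x ^+ q.-1 = 1.
Proof.
move=> x0; have := expf_card x; rewrite (card_Fp q_pr).
rewrite (_ : x ^+ q = x * x ^+ q.-1); last first.
  by rewrite -exprS prednK // prime_gt0.
by move=> h; apply: (mulfI x0); rewrite mulr1.
Qed.

Lemma Fp_primitive_root : exists g : F, (q.-1).-primitive_root g.
Proof.
have q1 : (0 < q.-1)%N by rewrite -pred2K.
have cF : #|F| = q by exact: card_Fp.
have := @has_prim_root F q.-1 (enum [pred x : F | x != 0]) q1.
have h1 : all (q.-1).-unity_root (enum [pred x : F | x != 0]).
  apply/allP => x; rewrite mem_enum inE => /Fp_expf_pred h.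
  by rewrite unity_rootE h.
have h3 : (q.-1 <= size (enum [pred x : F | x != 0%R]))%N.
  by rewrite -cardE (cardC1 (0%R : F)) cF.
by move=> /(_ h1 (enum_uniq _) h3)/hasP[g _ hg]; exists g.
Qed.

Definition genF : F := odflt 0 [pick g : F | (q.-1).-primitive_root g].

Lemma genFP : (q.-1).-primitive_root genF.
Proof.
rewrite /genF; case: pickP => [g //|h].
by have [g hg] := Fp_primitive_root; have := h g; rewrite hg.
Qed.

(** Discrete logarithm to the base [genF]. The default [ord0] is reached only at [x = 0], which
    [chi] treats separately. *)
Definition dlog (x : F) : nat := odflt ord0 [pick i : I | x == genF ^+ i].

Lemma genF_neq0 : genF != 0.
Proof.
apply/eqP => g0; have /eqP := prim_expr_order genFP.
by rewrite g0 expr0n -pred2K /= eq_sym oner_eq0.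
Qed.

Lemma dlogK x : x != 0 -> genF ^+ dlog x = x.
Proof.
move=> x0; rewrite /dlog; case: pickP => [i /eqP -> //|h].
have [i e] := prim_rootP genFP (Fp_expf_pred x0).
have := h (cast_ord (esym pred2K) i); by rewrite /= e eqxx.
Qed.

(* [chi j] sends a fixed primitive root to [exp (2 pi i j / (q - 1))]. *)
Definition chi (j : I) (x : F) : C :=
  if x == 0 then 0 else cis ((j * dlog x)%:R / q.-1%:R).

Lemma cis_int (n : nat) : cis n%:R = 1 :> C.
Proof. by have := cisX (1 : R) n; rewrite cis1 expr1n mul1r => <-. Qed.

Lemma cis_mod (m n : nat) :
  (m = n %[mod q.-1])%N -> cis (m%:R / q.-1%:R) = cis (n%:R / q.-1%:R) :> C.
Proof.
have H k : cis (k%:R / q.-1%:R) = cis ((k %% q.-1)%N%:R / q.-1%:R) :> C.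
  have q0 : (q.-1)%:R != 0 :> R by rewrite pnatr_eq0 -pred2K.
  rewrite {1}(divn_eq k q.-1) natrD natrM mulrDl mulfK // cisD cis_int mul1r //.
by move=> e; rewrite H e -H.
Qed.

Lemma chi0r j : chi j 0 = 0. Proof. by rewrite /chi eqxx. Qed.

Lemma chi_gen j k : chi j (genF ^+ k) = cis ((j * k)%N%:R / q.-1%:R).
Proof.
rewrite /chi expf_eq0 (negPf genF_neq0) andbF; apply: cis_mod.
have := dlogK (expf_neq0 k genF_neq0) => /eqP.
rewrite (eq_prim_root_expr genFP) => /eqP e.
by rewrite -modnMmr e modnMmr.
Qed.

Lemma chiM j x y : chi j (x * y) = chi j x * chi j y.
Proof.
have [->|x0] := eqVneq x 0; first by rewrite mul0r chi0r mul0r.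
have [->|y0] := eqVneq y 0; first by rewrite mulr0 chi0r mulr0.
rewrite -(dlogK x0) -(dlogK y0) -exprD !chi_gen -cisD.
by rewrite -mulrDl -natrD mulnDr.
Qed.

Lemma chi1 j : chi j 1 = 1.
Proof. by rewrite -(expr0 genF) chi_gen muln0 mul0r cis0. Qed.

Lemma normc_chi j x : x != 0 -> normc (chi j x) = 1.
Proof. by rewrite /chi => /negPf ->; exact: normc_cis. Qed.

Lemma normc_chi_le1 j x : normc (chi j x) <= 1.
Proof.
have [->|/(normc_chi j)->//] := eqVneq x 0.
by rewrite chi0r Normc.normc0.
Qed.

Lemma chi_neq0 j x : (chi j x == 0) = (x == 0).
Proof.
have [->|x0] := eqVneq x 0; first by rewrite chi0r eqxx.
apply/negbTE/eqP => h; have := normc_chi j x0.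
by rewrite h Normc.normc0 => /eqP; rewrite eq_sym oner_eq0.
Qed.

Lemma chiV j x : chi j x^-1 = (chi j x)^-1.
Proof.
have [->|x0] := eqVneq x 0; first by rewrite invr0 chi0r invr0.
have n0 : chi j x != 0 by rewrite chi_neq0.
by apply: (mulfI n0); rewrite -chiM !divff // chi1.
Qed.

Lemma chiD i j x : chi (i + j) x = chi i x * chi j x.
Proof.
have [->|x0] := eqVneq x 0; first by rewrite !chi0r mulr0.
rewrite -(dlogK x0) !chi_gen -cisD -mulrDl -natrD -mulnDl; apply: cis_mod.
have -> : nat_of_ord (i + j) = ((i + j) %% q.-1)%N.
  exact: (congr1 (modn (i + j)) pred2K).
by rewrite modnMml.
Qed.

Lemma chi_triv x : x != 0 -> chi 0 x = 1.
Proof. by move=> x0; rewrite -(dlogK x0) chi_gen mul0n mul0r cis0. Qed.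

Lemma chiN i x : chi (- i) x = chi i x^-1.
Proof.
have [->|x0] := eqVneq x 0; first by rewrite invr0 !chi0r.
have n0 : chi i x != 0 by rewrite chi_neq0.
by apply: (mulfI n0); rewrite -chiD subrr chiV divff // chi_triv.
Qed.

Lemma chi_conj i x : chi i x^-1 = ((chi i x)^*)%C.
Proof.
have [->|x0] := eqVneq x 0; first by rewrite invr0 !chi0r; exact: esym (conjc0 R).
have n0 : chi i x != 0 by rewrite chi_neq0.
apply: (mulfI n0); rewrite -chiM divff // chi1 mulcJ normc_chi //.
by rewrite expr1n.
Qed.

(** Up to half of [q - 1] the chord bound [normc_1Bcis_ge] keeps the value away from 1; beyond that,
    [k] is replaced by [q - 1 - k], since the two values multiply to [cis 1 = 1]. *)
Lemma cis_small_neq1 k : (0 < k < q.-1)%N -> cis (k%:R / q.-1%:R) != 1 :> C.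
Proof.
move=> /andP[k0 kq]; apply/eqP => h.
have q0 : 0 < (q.-1)%:R :> R by rewrite ltr0n -pred2K.
have key (l : nat) : (0 < l)%N -> (2 * l <= q.-1)%N -> cis (l%:R / q.-1%:R) = 1 :> C -> False.
  move=> l0 lq hl.
  have := @normc_1Bcis_ge R (l%:R / q.-1%:R).
  rewrite hl subrr Normc.normc0.
  have p : 0 < l%:R / q.-1%:R :> R by rewrite divr_gt0 // ltr0n.
  move=> /(_ p); rewrite ler_pdivrMr // => /(_ _)/wrap[|]; last by lra.
  rewrite -(ler_pM2l (_ : 0 < 2)) // mulrA divff // mul1r -natrM ler_nat //.
have [h2|h2] := leqP (2 * k)%N q.-1; first exact: key h.
apply: (key (q.-1 - k)%N); [by rewrite subn_gt0 | by lia |].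
rewrite natrB; last exact: ltnW.
apply: (mulIf (_ : cis (k%:R / q.-1%:R) != 0)); first by rewrite h oner_neq0.
by rewrite -cisD -mulrDl subrK divff ?lt0r_neq0 // cis1 h mulr1.
Qed.

Lemma chi_gen_neq1 j : j != 0 -> chi j genF != 1.
Proof.
move=> j0; rewrite -[genF]expr1 chi_gen muln1; apply: cis_small_neq1.
by rewrite lt0n j0 (leq_trans (ltn_ord j) (eq_leq pred2K)).
Qed.

Lemma sum_chi_x j : j != 0 -> \sum_(x | x != 0) chi j x = 0.
Proof.
move=> j0; have h := chi_gen_neq1 j0.
have e : chi j genF * (\sum_(x | x != 0) chi j x) = \sum_(x | x != 0) chi j x.
  rewrite mulr_sumr [RHS](reindex_inj (mulfI genF_neq0)) /=.
  apply: eq_big => [x|x _]; last by rewrite chiM.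
  by rewrite mulf_eq0 negb_or genF_neq0.
apply/eqP; move/eqP: e; rewrite -subr_eq0 -{2}[\sum_(x | _) _]mul1r -mulrBl mulf_eq0.
by rewrite subr_eq0 (negPf h).
Qed.

Lemma sum_chi_j x : x != 0 -> \sum_j chi j x = if x == 1 then (q.-1)%:R else 0.
Proof.
move=> x0; have [->|x1] := eqVneq x 1.
  by under eq_bigr do rewrite chi1; rewrite sumr_const card_ord pred2K.
have [j h] : exists j : I, chi j x != 1.
  have [q2|q2] := ltnP 1 q.-2.+1.
    exists (inord 1); rewrite -(dlogK x0) chi_gen inordK // mul1n.
    apply: cis_small_neq1; apply/andP; split.
      by rewrite lt0n; apply: contra_neq x1 => e; rewrite -(dlogK x0) e.
    exact: leq_trans (ltn_ord _) (eq_leq pred2K).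
  (* Here [q = 2]: the index type has one element, so [x = genF ^+ 0 = 1]. *)
  have := dlogK x0; rewrite /dlog; set i := odflt _ _ => e.
  by case/eqP: x1; rewrite -e; case: i {e} => -[|i] //= /leq_trans/(_ q2).
have e : chi j x * (\sum_j chi j x) = \sum_j chi j x.
  rewrite mulr_sumr [RHS](reindex_inj (addrI j)) /=.
  by apply: eq_bigr => i _; rewrite chiD.
apply/eqP; move/eqP: e; rewrite -subr_eq0 -{2}[\sum_j _]mul1r -mulrBl mulf_eq0.
by rewrite subr_eq0 (negPf h).
Qed.

End Characters.

(** * Fourier analysis on the multiplicative group of ['F_q] *)

Section Fourier.
Variables (R : realType) (q : nat) (q_pr : prime q).
Local Notation C := (R[i]).
Local Notation F := 'F_q.
Local Notation I := 'I_(q.-2.+1).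
Local Notation chi := (@chi R q).
Implicit Types (f g h : F -> R) (i j t : I).

Definition hat f j : C := \sum_(x : F | x != 0) ((f x)%:C)%C * chi j x.

Definition acorr f (z : F) : R := \sum_(y : F | y != 0) f (z * y) * f y.

Lemma hatD f g j : hat (fun x => f x + g x) j = hat f j + hat g j.
Proof.
by rewrite /hat -big_split; apply: eq_bigr => x _; rewrite /= rmorphD mulrDl.
Qed.

Lemma hatZ (c : R) f j : hat (fun x => c * f x) j = (c%:C)%C * hat f j.
Proof.
by rewrite /hat mulr_sumr; apply: eq_bigr => x _; rewrite rmorphM mulrA.
Qed.

Lemma hat_cst (c : R) j : j != 0 -> hat (fun => c) j = 0.
Proof. by move=> j0; rewrite /hat -mulr_sumr sum_chi_x // mulr0. Qed.

Lemma hat_triv f : hat f 0 = ((\sum_(x : F | x != 0) f x)%:C)%C.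
Proof.
by rewrite rmorph_sum; apply: eq_bigr => x x0; rewrite chi_triv // mulr1.
Qed.

Lemma eq_hat f g j : (forall x, x != 0 -> f x = g x) -> hat f j = hat g j.
Proof. by move=> h; apply: eq_bigr => x x0; rewrite h. Qed.

Lemma hat_conj f j : ((hat f j)^*)%C = \sum_(x : F | x != 0) ((f x)%:C)%C * chi j x^-1.
Proof.
rewrite /hat rmorph_sum; apply: eq_bigr => x x0.
by rewrite rmorphM chi_conj //=; congr (_ * _); apply/eqP; rewrite eq_complex /= oppr0 !eqxx.
Qed.

(** Substituting [x * y] for [x] in the product of [hat f j] and its conjugate makes [acorr f] the
    kernel of the spectral function [|hat f|^2]. *)
Lemma hat_acorr f j : hat (acorr f) j = ((normc (hat f j) ^+ 2)%:C)%C.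
Proof.
rewrite -mulcJ hat_conj {2}/hat /hat mulr_sumr.
under eq_bigr do rewrite /acorr rmorph_sum mulr_suml.
rewrite exchange_big /=; apply: eq_bigr => y y0.
rewrite mulr_suml [RHS](reindex_inj (mulIf y0)) /=.
apply: eq_big => [x|x _]; first by rewrite mulf_eq0 negb_or y0 andbT.
rewrite rmorphM chiM // chiV //.
have n0 : chi j y != 0 by rewrite chi_neq0.
by field.
Qed.

(** Fourier inversion at [z]: orthogonality over the index keeps only [x = z]. *)
Lemma sum_hat_shift f z : z != 0 ->
  \sum_i \sum_(x : F | x != 0) ((f x)%:C)%C * chi i (x * z^-1) = (q.-1)%:R * ((f z)%:C)%C.
Proof.
move=> z0; rewrite exchange_big (bigD1 z) //= [X in _ + X]big1 ?addr0.
  by rewrite -mulr_sumr divff // sum_chi_j ?oner_neq0 // eqxx mulrC.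
move=> x /andP[x0 xz]; rewrite -mulr_sumr sum_chi_j //; last first.
  by rewrite mulf_neq0 ?invr_eq0.
rewrite ifN ?mulr0 //; apply: contra xz => /eqP e.
by rewrite -[x](mulfVK z0) e mul1r.
Qed.

Lemma sum_hat f : \sum_i hat f i = (((q.-1)%:R * f 1)%:C)%C.
Proof.
rewrite rmorphM rmorph_nat -sum_hat_shift ?oner_neq0 //.
by apply: eq_bigr => i _; apply: eq_bigr => x _; rewrite invr1 mulr1.
Qed.

Lemma parseval f :
  \sum_i normc (hat f i) ^+ 2 = (q.-1)%:R * \sum_(x : F | x != 0) f x ^+ 2.
Proof.
apply: complexI; rewrite rmorph_sum /=.
under eq_bigr do rewrite -hat_acorr.
rewrite sum_hat; congr ((_ * _)%:C)%C.
by apply: eq_bigr => y _; rewrite mul1r expr2.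
Qed.

(** Convolution on the dual group is pointwise product on the group. Opening the third transform at
    [z] leaves the factors [chi i z^-1] and [chi j z^-1], so the sums over [i] and [j] become two
    inversions at [z]. *)
Lemma conv3 f t :
  \sum_i \sum_j hat f i * hat f j * hat f (t - i - j) =
  (q.-1)%:R ^+ 2 * \sum_(z : F | z != 0) ((f z ^+ 3)%:C)%C * chi t z.
Proof.
pose T i z := \sum_(x : F | x != 0) ((f x)%:C)%C * chi i (x * z^-1).
have e i j : hat f i * hat f j * hat f (t - i - j) =
    \sum_(z : F | z != 0) ((f z)%:C)%C * chi t z * (T i z * T j z).
  rewrite mulr_sumr; apply: eq_bigr => z z0.
  have eT k : T k z = hat f k * chi k z^-1.
    by rewrite /hat mulr_suml; apply: eq_bigr => x _; rewrite chiM // mulrA.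
  by rewrite !eT !chiD // !chiN //; ring.
under eq_bigr do under eq_bigr do rewrite e.
under eq_bigr do rewrite exchange_big /=.
rewrite exchange_big mulr_sumr; apply: eq_bigr => z z0 /=.
under eq_bigr do rewrite -mulr_sumr.
rewrite -mulr_sumr.
under eq_bigr do rewrite -mulr_sumr.
rewrite -mulr_suml (sum_hat_shift _ z0) rmorphXn /=; ring.
Qed.

(* A pointwise majorization of nonnegative spectral functions becomes an
   [L^3] bound on the kernel of the majorant. *)
Lemma conv3_le (A B : I -> R) h t :
  (forall j, 0 <= A j <= B j) -> (forall j, hat h j = ((B j)%:C)%C) ->
  \sum_i \sum_j A i * A j * A (t - i - j) <=
  (q.-1)%:R ^+ 2 * \sum_(z : F | z != 0) `|h z| ^+ 3.
Proof.
move=> AB hB.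
apply: (@le_trans _ _ (\sum_i \sum_j B i * B j * B (t - i - j))).
  apply: ler_sum => i _; apply: ler_sum => j _.
  have /andP[ai bi] := AB i; have /andP[aj bj] := AB j.
  have /andP[ak bk] := AB (t - i - j).
  by rewrite !ler_pM // mulr_ge0.
have e : ((\sum_i \sum_j B i * B j * B (t - i - j))%:C)%C =
  (q.-1)%:R ^+ 2 * \sum_(z : F | z != 0) ((h z ^+ 3)%:C)%C * chi t z.
  rewrite -conv3 rmorph_sum; apply: eq_bigr => i _.
  by rewrite rmorph_sum; apply: eq_bigr => j _; rewrite !rmorphM !hB.
have B0 j : 0 <= B j by have /andP[a b] := AB j; apply: le_trans b.
set S := \sum_i _ in e *.
have S0 : 0 <= S by do 2 (apply: sumr_ge0 => ? _); rewrite !mulr_ge0.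
(* The sum is nonnegative, hence equal to its modulus, and the triangle inequality on the kernel
   side removes the dependence on [t]. *)
rewrite -(ger0_norm S0) -normc_real e Normc.normcM normcX.
rewrite -(rmorph_nat (real_complex R)) normc_real normr_nat.
rewrite ler_wpM2l ?exprn_ge0 //.
apply: le_trans (normc_sum _ _ _) _; apply: ler_sum => z z0.
by rewrite Normc.normcM normc_real normc_chi // mulr1 normrX.
Qed.

End Fourier.

(** * Sums of powers of [n^(-1/2)], and harmonic sums *)

Section RSqrt.
Variable R : realType.

Definition rsq (n : nat) : R := (Num.sqrt (n%:R))^-1.

Lemma rsq_ge0 n : 0 <= rsq n.
Proof. by rewrite invr_ge0 sqrtr_ge0. Qed.

Lemma rsq_gt0 n : (0 < n)%N -> 0 < rsq n.
Proof. by move=> n0; rewrite invr_gt0 sqrtr_gt0 ltr0n. Qed.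

Lemma rsq_sqr n : rsq n ^+ 2 = n%:R^-1.
Proof. by rewrite exprVn sqr_sqrtr. Qed.

Lemma rsq1 : rsq 1 = 1.
Proof. by rewrite /rsq sqrtr1 invr1. Qed.

Lemma rsqM m n : rsq (m * n) = rsq m * rsq n.
Proof. by rewrite /rsq natrM sqrtrM // invfM. Qed.

Lemma rsq_le m n : (0 < m)%N -> (m <= n)%N -> rsq n <= rsq m.
Proof.
move=> m0 mn; rewrite /rsq lef_pV2 ?posrE ?sqrtr_gt0 ?ltr0n //.
  by rewrite ler_wsqrtr // ler_nat.
exact: leq_trans mn.
Qed.

Lemma sqrtn_sqr n : Num.sqrt (n%:R : R) ^+ 2 = n%:R.
Proof. by rewrite sqr_sqrtr. Qed.

Lemma rsqE_sqrt n : (0 < n)%N -> rsq n * Num.sqrt n%:R = 1.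
Proof. by move=> n0; rewrite mulVf // gt_eqF // sqrtr_gt0 ltr0n. Qed.

Lemma sum_rsq_le n : \sum_(1 <= i < n.+1) rsq i <= 2 * Num.sqrt n%:R.
Proof.
elim: n => [|n IH]; first by rewrite big_geq // mulr_ge0 // sqrtr_ge0.
rewrite big_nat_recr //=; apply: le_trans (lerD IH (lexx _)) _.
have a0 := sqrtr_ge0 (n%:R : R); have b2 := sqrtn_sqr n.+1; have a2 := sqrtn_sqr n.
have hb := @rsqE_sqrt n.+1 isT; have h0 := rsq_ge0 n.+1.
rewrite -natr1 in b2 hb *.
set a := Num.sqrt _ in a0 a2 *; set b := Num.sqrt _ in b2 hb *.
set h := rsq _ in hb h0 *.
(* Inserting [b ^+ 2 - a ^+ 2 = 1] and [h * b = 1] makes both sides homogeneous; they then differ by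
   [h * (b - a) ^+ 2]. *)
have -> : h = h * (b ^+ 2 - a ^+ 2) by rewrite b2 a2; ring.
have -> : 2 * b = 2 * a + 2 * (b - a) * (h * b) by rewrite hb; ring.
have : 0 <= h * (b - a) ^+ 2 by rewrite mulr_ge0 // sqr_ge0.
rewrite !expr2; lra.
Qed.

Lemma sum_rsq_ge n : 2 * Num.sqrt n.+1%:R - 2 <= \sum_(1 <= i < n.+1) rsq i.
Proof.
elim: n => [|n IH]; first by rewrite big_geq // sqrtr1; lra.
rewrite big_nat_recr //=; apply: le_trans (lerD IH (lexx _)).
have b0 := sqrtr_ge0 (n.+2%:R : R); have b2 := sqrtn_sqr n.+2; have a2 := sqrtn_sqr n.+1.
have hb := @rsqE_sqrt n.+1 isT; have h0 := rsq_ge0 n.+1.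
rewrite -(natr1 n.+1) in b2 b0 *.
set a := Num.sqrt _ in hb a2 *; set b := Num.sqrt _ in b2 b0 *.
set h := rsq _ in hb h0 *.
have -> : h = h * (b ^+ 2 - a ^+ 2) by rewrite b2 a2; ring.
have -> : 2 * b - 2 = 2 * a - 2 + 2 * (b - a) * (h * a) by rewrite hb; ring.
have : 0 <= h * (b - a) ^+ 2 by rewrite mulr_ge0 // sqr_ge0.
rewrite !expr2; lra.
Qed.

Lemma sum_inv_le n : (0 < n)%N -> \sum_(1 <= i < n.+1) (i%:R : R)^-1 <= 1 + ln n%:R.
Proof.
elim: n => [//|[|n] IH] _; first by rewrite big_nat1 invr1 ln1 addr0.
rewrite big_nat_recr //=; apply: le_trans (lerD (IH isT) (lexx _)) _.
rewrite -addrA lerD2l -lerBrDl.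
have p1 : 0 < n.+1%:R :> R by rewrite ltr0n.
have p2 : 0 < n.+2%:R :> R by rewrite ltr0n.
have i0 : 0 < (n.+2%:R : R)^-1 by rewrite invr_gt0.
rewrite -lerN2 opprB -ln_div ?posrE //.
have -> : (n.+1%:R : R) / n.+2%:R = 1 + (- n.+2%:R^-1).
  by rewrite -(natr1 n.+1); field; apply: lt0r_neq0; lra.
apply: le_ln1Dx; rewrite ltrN2 invf_lt1 // ltr1n //.
Qed.

(* [d x^(-3/2)] is dominated by the telescoping difference of
   [2 x^(-1/2)] over a step of length [d]. *)
Lemma rsq3_telescope n d : (0 < n)%N ->
  d%:R * rsq (n + d) ^+ 3 <= 2 * (rsq n - rsq (n + d)).
Proof.
move=> n0; have nd0 : (0 < n + d)%N by rewrite addn_gt0 n0.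
have a2 := sqrtn_sqr n; have b2 := sqrtn_sqr (n + d).
have ha := rsqE_sqrt n0; have hb := rsqE_sqrt nd0.
have ab : rsq (n + d) <= rsq n by apply: rsq_le => //; exact: leq_addr.
have u0 := rsq_gt0 n0; have v0 := rsq_gt0 nd0.
have a0 : 0 < Num.sqrt (n%:R : R) by rewrite sqrtr_gt0 ltr0n.
have b0 : 0 < Num.sqrt ((n + d)%:R : R) by rewrite sqrtr_gt0 ltr0n.
have sab : Num.sqrt (n%:R : R) <= Num.sqrt (n + d)%:R.
  by rewrite ler_wsqrtr // ler_nat leq_addr.
have -> : d%:R = (n + d)%:R - n%:R :> R by rewrite natrD; ring.
rewrite -{1}b2 -a2.
set u := rsq n in ha ab u0 *; set v := rsq (n + d) in hb ab v0 *.
set a := Num.sqrt n%:R in a2 ha a0 sab *; set b := Num.sqrt _ in b2 hb b0 sab *.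
have -> : (b ^+ 2 - a ^+ 2) * v ^+ 3 = (b - a) * v * ((a + b) * v * v) by ring.
have -> : 2 * (u - v) = (b - a) * v * (2 * u).
  have -> : 2 * (u - v) = 2 * (u * (v * b) - v * (u * a)) by rewrite hb ha !mulr1.
  by ring.
apply: ler_wpM2l; first by apply: mulr_ge0; [rewrite subr_ge0|exact: ltW].
have : (a + b) * v <= 2 by have := ler_wpM2r (ltW v0) sab; lra.
move=> h; apply: le_trans (ler_wpM2r (ltW v0) h) _.
by rewrite ler_pM2l.
Qed.

Lemma sum_rsq3_le n : \sum_(1 <= i < n) rsq i ^+ 3 <= 3.
Proof.
have H k : \sum_(1 <= i < k.+2) rsq i ^+ 3 <= 3 - 2 * rsq k.+1.
  elim: k => [|k IH]; first by rewrite big_nat1 rsq1 expr1n; lra.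
  rewrite big_nat_recr //=.
  have := @rsq3_telescope k.+1 1 isT; rewrite addn1 mul1r.
  by move: IH; lra.
case: n => [|[|n]]; [by rewrite big_geq|by rewrite big_geq|].
by apply: le_trans (H n) _; have := rsq_ge0 n.+1; lra.
Qed.

(** The term at 3 is kept and the rest telescopes in steps of length 2. A bound below 1 is
    essential: it lets the term at 1 dominate the sum over odd integers in [sum_rsq3_chi_ge]. *)
Lemma sum_rsq3_odd_le n : \sum_(1 <= k < n) rsq (k.*2.+1) ^+ 3 <= 4 / 5.
Proof.
have h3 : rsq 3 ^+ 2 = 3^-1 by rewrite rsq_sqr.
have p3 : 0 < rsq 3 by apply: rsq_gt0.
have c3 : rsq 3 ^+ 3 + rsq 3 <= 4 / 5.
  have -> : rsq 3 ^+ 3 + rsq 3 = (4 / 3) * rsq 3 by rewrite exprS h3; lra.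
  have : rsq 3 <= 3 / 5.
    by rewrite -(@ler_pXn2r _ 2) ?nnegrE ?ltW // h3 !expr2; lra.
  lra.
have H k : \sum_(1 <= i < k.+2) rsq (i.*2.+1) ^+ 3 <= 4 / 5 - rsq (k.*2.+3).
  elim: k => [|k IH]; first by rewrite big_nat1 /=; move: c3; lra.
  rewrite big_nat_recr //=.
  have := @rsq3_telescope (k.*2.+3) 2 isT; rewrite addn2 !doubleS.
  by move: IH; lra.
case: n => [|[|n]]; [by rewrite big_geq //; lra|by rewrite big_geq //; lra|].
by apply: le_trans (H n) _; have := rsq_ge0 (n.*2.+3); lra.
Qed.

Lemma sum_invsq_le n : \sum_(1 <= i < n) ((i%:R : R) ^+ 2)^-1 <= 2.
Proof.
have H k : \sum_(1 <= i < k.+2) ((i%:R : R) ^+ 2)^-1 <= 2 - (k.+1%:R)^-1.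
  elim: k => [|k IH]; first by rewrite big_nat1 expr1n invr1; lra.
  rewrite big_nat_recr //= -(natr1 k.+1).
  have p : 0 < (k.+1%:R : R) by rewrite ltr0n.
  set x := k.+1%:R in p IH *.
  have e : x^-1 - (x + 1)^-1 = (x * (x + 1))^-1 by field; rewrite ?lt0r_neq0 //; lra.
  have : ((x + 1) ^+ 2)^-1 <= (x * (x + 1))^-1.
    by rewrite lef_pV2 ?posrE; nra.
  move: IH e; set S := \sum_(_ <= _ < _) _; set u := _ ^- 2; set v := (_ * _)^-1.
  set w := x^-1; set z := (x + 1)^-1; lra.
case: n => [|[|n]]; [by rewrite big_geq|by rewrite big_geq|].
by apply: le_trans (H n) _; rewrite lerBlDr lerDl invr_ge0.
Qed.

End RSqrt.

(** * Limits of complex sequences *)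

Section ComplexLimit.
Variable R : realType.
Local Notation C := (R[i]).

Definition ccvg (u : nat -> C) (l : C) : Prop :=
  forall e : R, 0 < e -> exists N, forall n, (N <= n)%N -> normc (u n - l) <= e.

Lemma Re_le_normc (z : C) : `|complex.Re z| <= normc z.
Proof.
rewrite -ler_sqr ?nnegrE ?normc_ge0 // normc_sqr real_normK ?num_real //.
by rewrite lerDl sqr_ge0.
Qed.

Lemma Im_le_normc (z : C) : `|complex.Im z| <= normc z.
Proof.
rewrite -ler_sqr ?nnegrE ?normc_ge0 // normc_sqr real_normK ?num_real //.
by rewrite lerDr sqr_ge0.
Qed.

(** Converts convergence in modulus into the form used by [Lhalf], which takes the limits of real
    and imaginary parts separately. *)
Lemma ccvg_lim u l : ccvg u l ->
  (limn (fun n => complex.Re (u n)) +i* limn (fun n => complex.Im (u n)))%C = l.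
Proof.
move=> h; have [h1 h2] : ((fun n => complex.Re (u n)) @ \oo --> complex.Re l)%classic /\
                ((fun n => complex.Im (u n)) @ \oo --> complex.Im l)%classic.
  split; apply/cvgrPdist_le => e e0; have [N hN] := h e e0; exists N => // n /= Nn;
    rewrite distrC.
    by apply: le_trans (hN n Nn); rewrite -raddfB; exact: Re_le_normc.
  by apply: le_trans (hN n Nn); rewrite -raddfB; exact: Im_le_normc.
rewrite (cvg_lim _ h1) // (cvg_lim _ h2) //.
by case: l {h h1 h2}.
Qed.

Lemma ccvg_normc_le u l (c : R) : ccvg u l ->
  (forall e, 0 < e -> exists N, forall n, (N <= n)%N -> normc (u n) <= c + e) ->
  normc l <= c.
Proof.
move=> h hu; apply/ler_addgt0Pr => e e0.
have e2 : 0 < e / 2 by rewrite divr_gt0.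
have [N hN] := h _ e2; have [M hM] := hu _ e2.
have a := hN (maxn N M) (leq_maxl _ _); have b := hM (maxn N M) (leq_maxr _ _).
have -> : l = u (maxn N M) - (u (maxn N M) - l) by ring.
apply: le_trans (le_normcD _ _) _; rewrite normcN; lra.
Qed.

End ComplexLimit.

(** * The regularized kernel and conditionally convergent periodic series *)

Section Kernel.
Variables (R : realType) (q : nat) (q_gt0 : (0 < q)%N).
Local Notation C := (R[i]).
Local Notation rsq := (@rsq R).

Definition pkern (x k : nat) : R :=
  \sum_(0 <= j < k) (rsq (x + j * q) - rsq (q + j * q)).

(* The sum of [n^(-1/2)] over [n = x mod q], regularized by subtracting the
   same sum over [n = 0 mod q]. *)
Definition kern (x : nat) : R := limn (pkern x).

Lemma pkern_nd x : (0 < x <= q)%N ->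
  {homo pkern x : m n / (m <= n)%N >-> m <= n}.
Proof.
move=> /andP[x0 xq] m n mn; rewrite /pkern (big_cat_nat (leq0n m) mn) /= lerDl.
rewrite sumr_ge0 // => j _; rewrite subr_ge0 rsq_le ?addn_gt0 ?x0 //.
by rewrite leq_add2r.
Qed.

(** Since [x > 0], the subtracted [rsq (q + j * q)] is at least the next positive term
    [rsq (x + j.+1 * q)], so the tail is dominated by a telescoping sum. *)
Lemma pkern_diff x k l : (0 < x <= q)%N -> (k <= l)%N ->
  pkern x l <= pkern x k + rsq (x + k * q).
Proof.
move=> /andP[x0 xq] kl; rewrite /pkern (big_cat_nat (leq0n k) kl) /= lerD2l.
apply: (@le_trans _ _ (\sum_(k <= j < l) (- rsq (x + j.+1 * q) - - rsq (x + j * q)))).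
  apply: ler_sum_nat => j _; rewrite opprK [- _ + _]addrC lerB // rsq_le //.
    by rewrite addn_gt0 q_gt0.
  by rewrite mulSn addnA leq_add2r leq_addl.
rewrite telescope_sumr // opprK addrC lerBlDr lerDl rsq_ge0 //.
Qed.

Lemma kern_cvg x : (0 < x <= q)%N -> (pkern x @ \oo --> kern x)%classic.
Proof.
move=> hx; apply: (nondecreasing_is_cvgn (pkern_nd hx)).
exists (pkern x 0 + rsq (x + 0 * q)) => _ [n _ <-].
exact: pkern_diff.
Qed.

Lemma pkern_le_kern x k : (0 < x <= q)%N -> pkern x k <= kern x.
Proof.
move=> hx; apply: (nondecreasing_cvgn_le (pkern_nd hx)).
exact/cvgP/(kern_cvg hx).
Qed.

Lemma kern_le_pkern x k : (0 < x <= q)%N -> kern x <= pkern x k + rsq (x + k * q).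
Proof.
move=> hx; rewrite /kern; apply: limr_le; first exact/cvgP/(kern_cvg hx).
by exists k => // n /= kn; exact: pkern_diff.
Qed.

Lemma kern_le x : (0 < x <= q)%N -> kern x <= rsq x.
Proof.
by move=> hx; have := kern_le_pkern 0 hx; rewrite /pkern big_geq // add0r mul0n addn0.
Qed.

Lemma kern_ge x : (0 < x <= q)%N -> rsq x - rsq q <= kern x.
Proof.
by move=> hx; have := pkern_le_kern 1 hx; rewrite /pkern big_nat1 !mul0n !addn0.
Qed.

Variable g : nat -> C.
Hypothesis g_le1 : forall n, normc (g n) <= 1.
Hypothesis g_per : forall n, g (n + q) = g n.
Hypothesis g_sum0 : \sum_(1 <= x < q.+1) g x = 0.

Lemma g_perM k n : g (n + k * q) = g n.
Proof. by elim: k => [|k IH]; rewrite ?mul0n ?addn0 // mulSn addnCA addnC g_per. Qed.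

(** Over full periods the regularization is free: in each block the subtracted constant meets
    coefficients of sum 0. *)
Lemma twisted_psum k :
  \sum_(1 <= n < (k * q).+1) g n * ((rsq n)%:C)%C =
  \sum_(1 <= x < q.+1) g x * ((pkern x k)%:C)%C.
Proof.
elim: k => [|k IH].
  rewrite mul0n big_geq // big1 // => x _.
  by rewrite /pkern big_geq // mulr0.
rewrite (@big_cat_nat _ _ _ (k * q).+1) //=; last first.
  by rewrite ltnS leq_mul2r leqnSn orbT.
rewrite IH -[(k * q).+1]add1n [X in _ + X]big_addn.
have -> : ((k.+1 * q).+1 - k * q = q.+1)%N by rewrite mulSn -addSn addnK.
have e0 : \sum_(1 <= x < q.+1) g x * ((rsq (q + k * q))%:C)%C = 0.
  by rewrite -mulr_suml g_sum0 mul0r.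
rewrite -[LHS]subr0 -[X in _ - X = _]e0 -addrA -sumrB -big_split /=.
apply: eq_bigr => x _.
rewrite g_perM -mulrBr -mulrDr -rmorphB -rmorphD; congr (_ * _%:C)%C.
by rewrite /pkern big_nat_recr.
Qed.

Lemma twisted_psum_cvg :
  ccvg (fun N => \sum_(1 <= n < N.+1) g n * ((rsq n)%:C)%C)
       (\sum_(1 <= x < q.+1) g x * ((kern x)%:C)%C).
Proof.
move=> e e0.
(* For [k > M] one has [rsq (k * q) <= e / (2 * q)]. There are two errors, the truncation of the
   kernel at [k] and the incomplete last block; each is a sum of at most [q] terms of this size. *)
pose M := (Num.bound ((2 * q%:R / e) ^+ 2)).
exists (M * q + q)%N => n hn.
set k := (n %/ q)%N.
have kM : (M < k)%N by rewrite /k leq_divRL // mulSn addnC.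
have k0 : (0 < k)%N by apply: leq_trans kM.
have kq0 : (0 < k * q)%N by rewrite muln_gt0 k0.
have q0 : 0 < q%:R :> R by rewrite ltr0n.
have kqn : (k * q <= n)%N by exact: leq_trunc_div.
have nkq : (n < k * q + q)%N by rewrite addnC -mulSn ltn_ceil.
have ed : 0 < e / (2 * q%:R) by rewrite divr_gt0 // mulr_gt0.
have rle : rsq (k * q) <= e / (2 * q%:R).
  rewrite -ler_sqr ?nnegrE ?rsq_ge0 ?(ltW ed) // rsq_sqr.
  rewrite -[leRHS]invrK lef_pV2 ?posrE ?invr_gt0 ?exprn_gt0 ?ltr0n //.
  rewrite -exprVn invf_div.
  apply: le_trans (ltW (archi_boundP (sqr_ge0 _))) _.
  rewrite ler_nat; apply: leq_trans (ltnW kM) _; exact: leq_pmulr.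
rewrite (@big_cat_nat _ _ _ (k * q).+1) //= twisted_psum addrAC -sumrB.
apply: le_trans (le_normcD _ _) _.
have -> : e = (\sum_(1 <= x < q.+1) e / (2 * q%:R)) +
              (\sum_(1 <= x < q.+1) e / (2 * q%:R)).
  rewrite sumr_const_nat subSS subn0 -mulr_natr; field; exact: lt0r_neq0.
apply: lerD.
  apply: le_trans (normc_sum _ _ _) _; apply: ler_sum_nat => x /andP[x1 xq].
  have hx : (0 < x <= q)%N by rewrite x1 -ltnS.
  rewrite -mulrBr Normc.normcM -rmorphB normc_real; apply: le_trans rle.
  rewrite -[leRHS]mul1r ler_pM ?normc_ge0 //.
  rewrite distrC ger0_norm ?subr_ge0 ?pkern_le_kern // lerBlDl.
  apply: le_trans (kern_le_pkern k hx) _; rewrite lerD2l rsq_le //.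
  exact: leq_addl.
apply: le_trans (normc_sum _ _ _) _.
rewrite -[(k * q).+1]add1n big_addn.
have hk : (n.+1 - k * q <= q.+1)%N by rewrite leq_subLR addnS ltnS ltnW.
have [h1|h1] := leqP 1 (n.+1 - k * q)%N; last first.
  by rewrite big_geq ?sumr_ge0 // => [? _|]; [exact: ltW|exact: ltnW].
rewrite [leRHS](big_cat_nat h1 hk) /= -[leLHS]addr0; apply: lerD; last first.
  by apply: sumr_ge0 => i _; exact: ltW.
apply: ler_sum_nat => x /andP[x1 xq].
rewrite Normc.normcM normc_real ger0_norm ?rsq_ge0 //; apply: le_trans rle.
rewrite -[leRHS]mul1r ler_pM ?normc_ge0 ?rsq_ge0 // rsq_le //.
exact: leq_addl.
Qed.

End Kernel.

(** * The characters as functions on the natural numbers, and their L-values *)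

Section CharactersOnNat.
Variables (R : realType) (q : nat) (q_pr : prime q).
Local Notation C := (R[i]).
Local Notation F := 'F_q.
Local Notation I := 'I_(q.-2.+1).
Local Notation chi := (@chi R q).
Local Notation kern := (@kern R q).

Definition chin (j : I) (n : nat) : C := chi j n%:R.

Lemma sum_Fp_neq0 (V : nmodType) (f : nat -> V) :
  \sum_(x : F | x != 0) f x = \sum_(1 <= n < q) f n.
Proof.
transitivity (\sum_(0 <= n < (Zp_trunc (pdiv q)).+2 | n != 0%N) f n).
  by rewrite big_mkord.
rewrite Fp_cast // big_ltn_cond ?prime_gt0 //= big_nat_cond [RHS]big_nat_cond.
by apply: eq_bigl => -[|n].
Qed.

Lemma card_Fp_neq0 : \sum_(x : F | x != 0) (1 : R) = (q.-1)%:R.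
Proof.
by rewrite (@sum_Fp_neq0 _ (fun => 1)) sumr_const_nat subn1.
Qed.

Lemma Fp_nat_eq0 n : ((n%:R : F) == 0) = ~~ coprime n q.
Proof.
rewrite -(dvdn_pcharf (pchar_Fp q_pr)) coprime_sym prime_coprime //.
by rewrite negbK.
Qed.

Lemma val_Fp_bounds (x : F) : x != 0 -> (0 < x < q)%N.
Proof.
move=> x0; rewrite lt0n x0 /=.
by have := ltn_ord x; rewrite {2}(Fp_cast q_pr).
Qed.

Lemma val_Fp_small n : (n < q)%N -> ((n%:R : F) : nat) = n.
Proof. by move=> h; rewrite val_Fp_nat // modn_small. Qed.

Lemma chin_per j n : chin j (n + q) = chin j n.
Proof. by rewrite /chin natrD pchar_Fp_0 // addr0. Qed.

Lemma chin_dirichlet j : is_dirichlet_char q (chin j).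
Proof.
split=> [m n|n|n]; first by rewrite /chin natrM chiM.
  exact: chin_per.
by rewrite -Fp_nat_eq0 -(@chi_neq0 R q j); split=> /eqP.
Qed.

(** The only proper divisor of the prime [q] is 1, for which the congruence is empty; the generator
    is then a witness. *)
Lemma chin_primitive j : j != 0 -> is_primitive_char q (chin j).
Proof.
move=> j0; split; first exact: chin_dirichlet.
move=> d dq ltdq; exists (genF q : nat).
have /andP[d1 _] : (d == 1)%N && true.
  case/primeP: q_pr => _ /(_ d dq)/orP[->//|/eqP e].
  by rewrite e ltnn in ltdq.
rewrite (eqP d1) !modn1 /chin natr_Zp; split => //.
  by rewrite -[coprime _ _]negbK -Fp_nat_eq0 natr_Zp genF_neq0.
by apply/eqP; exact: chi_gen_neq1.
Qed.

Lemma chin_inj : injective chin.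
Proof.
move=> i j e; apply/eqP; rewrite -subr_eq0; apply: contraT => h.
have := @chi_gen_neq1 R q q_pr _ h; rewrite chiD // chiN // chiV //.
have -> : chi i (genF q) = chi j (genF q).
  by have := congr1 (fun f => f (genF q : nat)) e; rewrite /chin natr_Zp.
by rewrite divff ?eqxx // chi_neq0 // genF_neq0.
Qed.

Lemma chi_sum m (t : 'I_m -> I) x : x != 0 ->
  chi (\sum_(i < m) t i) x = \prod_(i < m) chi (t i) x.
Proof.
move=> x0; elim/big_rec2: _ => [|i y1 y2 _ <-]; first by rewrite chi_triv.
by rewrite chiD.
Qed.

Lemma prod_chin m (t : 'I_m.+1 -> I) : \sum_(i < m.+1) t i = 0 ->
  forall n, \prod_(i < m.+1) chin (t i) n = principal_char R q n.
Proof.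
move=> t0 n; rewrite /principal_char -[coprime n q]negbK -Fp_nat_eq0.
have [n0|n0] := eqVneq (n%:R : F) 0; last by rewrite -chi_sum // t0 chi_triv.
by rewrite big_ord_recl /chin n0 chi0r mul0r.
Qed.

(** [twisted_psum_cvg] applies because a nontrivial character sums to 0 over a period; the class of
    [q] drops out since the character vanishes there. *)
Lemma Lhalf_chin j : j != 0 -> Lhalf (chin j) = hat (fun x : F => kern x) j.
Proof.
move=> j0.
have cq : chin j q = 0 by rewrite /chin pchar_Fp_0 // chi0r.
have e (k : nat -> R) :
    \sum_(1 <= x < q.+1) chin j x * ((k x)%:C)%C = hat (fun x : F => k x) j.
  rewrite big_nat_recr ?prime_gt0 //= cq mul0r addr0.
  rewrite -(@sum_Fp_neq0 _ (fun x => chin j x * ((k x)%:C)%C)).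
  by apply: eq_bigr => x _; rewrite /chin natr_Zp mulrC.
rewrite -e /Lhalf; apply: ccvg_lim.
have -> : Lhalf_partial (chin j) = fun N => \sum_(1 <= n < N.+1) chin j n * ((rsq R n)%:C)%C.
  apply/funext => N; rewrite /Lhalf_partial; apply: eq_bigr => n _.
  by rewrite fmorphV.
apply: twisted_psum_cvg; first exact: prime_gt0.
- by move=> n; exact: normc_chi_le1.
- exact: chin_per.
have := e (fun => 1); rewrite hat_cst // => h; rewrite -[RHS]h.
by apply: eq_bigr => n _; rewrite mulr1.
Qed.

End CharactersOnNat.

(** * Elementary inequalities *)

Lemma sqr_sum_le (R : realFieldType) (T : finType) (A : {set T}) (a : T -> R) :
  (\sum_(i in A) a i) ^+ 2 <= #|A|%:R * \sum_(i in A) a i ^+ 2.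
Proof.
(* Cauchy-Schwarz in Lagrange form: expanding this double sum gives twice the difference of the two
   sides. *)
have h : 0 <= \sum_(i in A) \sum_(j in A) (a i - a j) ^+ 2.
  by do 2 (apply: sumr_ge0 => ? _); exact: sqr_ge0.
have e : \sum_(i in A) \sum_(j in A) (a i - a j) ^+ 2 =
    2 * (#|A|%:R * \sum_(i in A) a i ^+ 2) - 2 * (\sum_(i in A) a i) ^+ 2.
  have e1 i : \sum_(j in A) (a i - a j) ^+ 2 =
      #|A|%:R * a i ^+ 2 + \sum_(j in A) a j ^+ 2 - 2 * a i * \sum_(j in A) a j.
    have -> : #|A|%:R * a i ^+ 2 = \sum_(j in A) a i ^+ 2.
      by rewrite sumr_const mulr_natl.
    rewrite mulr_sumr -big_split -sumrB; apply: eq_bigr => j _ /=; ring.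
  under eq_bigr do rewrite e1.
  rewrite sumrB big_split /= -mulr_sumr sumr_const -mulr_suml -mulr_sumr -mulr_natl.
  by ring.
rewrite e in h; lra.
Qed.

Lemma cubeD_le (R : realFieldType) (x y : R) : 0 <= x -> 0 <= y ->
  (x + y) ^+ 3 <= 4 * x ^+ 3 + 4 * y ^+ 3.
Proof.
move=> x0 y0; have := mulr_ge0 (addr_ge0 x0 y0) (sqr_ge0 (x - y)).
have -> : (x + y) * (x - y) ^+ 2 = x ^+ 3 + y ^+ 3 - x * x * y - x * y * y by ring.
have -> : (x + y) ^+ 3 = x ^+ 3 + y ^+ 3 + 3 * (x * x * y + x * y * y) by ring.
lra.
Qed.

Lemma ln_ge1 (R : realType) (x : R) : 4 <= x -> 1 <= ln x.
Proof.
move=> x4; have h : ln ((2 : R) ^-1 ) <= - 2^-1.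
  have e : (2 : R)^-1 = 1 + - 2^-1 by lra.
  by rewrite {1}e; apply: le_ln1Dx; lra.
have h2 : ln ((2 : R) ^+ 2) <= ln x.
  by rewrite ler_ln ?posrE ?exprn_gt0 //; rewrite ?expr2; lra.
by move: h h2; rewrite lnV ?posrE // lnXn // -mulr_natl; lra.
Qed.

(** The bound [ln u < u] at the fourth root of [x]. It absorbs every logarithm into [q^(1/4)], the
    quantity in which largeness of [q] is measured. *)
Lemma ln_le_root4 (R : realType) (x : R) : 0 < x -> ln x <= 4 * Num.sqrt (Num.sqrt x).
Proof.
move=> x0; have s0 : 0 < Num.sqrt (Num.sqrt x) by rewrite !sqrtr_gt0.
have e : Num.sqrt (Num.sqrt x) ^+ 4 = x.
  rewrite (exprM _ 2 2) sqr_sqrtr ?sqrtr_ge0 // sqr_sqrtr //; exact: ltW.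
rewrite -{1}e lnXn // -[X in X <= _]mulr_natl ler_wpM2l //.
exact: ltW (ln_sublinear s0).
Qed.

(** * Nonvanishing for a proportion [1 / log q] of the characters *)

Section Nonvanishing.
Variables (R : realType) (q : nat) (q_pr : prime q).
Local Notation C := (R[i]).
Local Notation F := 'F_q.
Local Notation I := 'I_(q.-2.+1).
Local Notation chi := (@chi R q).
Local Notation kern := (@kern R q).
Local Notation rsq := (@rsq R).

Definition Lchi (j : I) : C := hat (fun x : F => kern x) j.

(** Index 0 is excluded: its character is not primitive, and [Lchi 0] is only the sum of the kernel,
    not a value of [Lhalf]. *)
Definition nonvan : {set I} := [set j : I | (j != 0) && (Lchi j != 0)].

Lemma kern_Fp_bounds (x : F) : x != 0 -> rsq x - rsq q <= kern x <= rsq x.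
Proof.
move=> x0; have /andP[h1 h2] := val_Fp_bounds q_pr x0.
have h : (0 < x <= q)%N by rewrite h1 ltnW.
have q0 := prime_gt0 q_pr.
by apply/andP; split; [exact: kern_ge | exact: kern_le].
Qed.

Let q0 : (0 < q)%N. Proof. exact: prime_gt0. Qed.
Let qK : q.-1.+1 = q. Proof. exact: prednK. Qed.
Let qR : 0 < q%:R :> R. Proof. by rewrite ltr0n. Qed.
Let s := Num.sqrt (q%:R : R).
Let s_gt0 : 0 < s. Proof. by rewrite sqrtr_gt0. Qed.
Let s2 : s ^+ 2 = q%:R. Proof. by rewrite sqr_sqrtr. Qed.

Lemma natr_pred : (q.-1)%:R = q%:R - 1 :> R.
Proof. by rewrite -{2}qK -natr1 addrK. Qed.

Lemma sum_Fp_rsq_le : \sum_(x : F | x != 0) rsq x <= 2 * s.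
Proof.
rewrite (sum_Fp_neq0 q_pr rsq); apply: le_trans (@sum_rsq_le R q).
by rewrite [leRHS]big_nat_recr //= lerDl rsq_ge0.
Qed.

Lemma sum_Fp_rsq_ge : 2 * s - 2 <= \sum_(x : F | x != 0) rsq x.
Proof.
rewrite (sum_Fp_neq0 q_pr rsq); have := @sum_rsq_ge R q.-1.
by rewrite qK.
Qed.

Lemma sum_Fp_inv_le : \sum_(x : F | x != 0) (x%:R : R)^-1 <= 1 + ln q%:R.
Proof.
rewrite (sum_Fp_neq0 q_pr (fun n => (n%:R : R)^-1)).
apply: le_trans (@sum_inv_le R q q0).
by rewrite [leRHS]big_nat_recr //= lerDl invr_ge0.
Qed.

Lemma sum_nonvan : \sum_(j in nonvan) Lchi j = \sum_(j | j != 0) Lchi j.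
Proof.
rewrite [RHS](bigID (fun j => Lchi j != 0)) /= [X in _ + X]big1 ?addr0.
  by apply: eq_bigl => j; rewrite inE.
by move=> j /andP[_]; rewrite negbK => /eqP.
Qed.

(** Subtracting the constant [rsq q] from the kernel is invisible to nontrivial characters. The
    cross term then contributes about -4, which turns [ln q + 1 + 2] into [ln q - 1]. *)
Lemma nonvan_second_moment :
  \sum_(j in nonvan) normc (Lchi j) ^+ 2 <= (q.-1)%:R * (ln q%:R - 1 + 4 / s).
Proof.
pose f (x : F) : R := kern x + - rsq q.
have -> : \sum_(j in nonvan) normc (Lchi j) ^+ 2 = \sum_(j in nonvan) normc (hat f j) ^+ 2.
  by apply: eq_bigr => j; rewrite inE => /andP[j0 _]; rewrite hatD hat_cst // addr0.
apply: (@le_trans _ _ (\sum_j normc (hat f j) ^+ 2)).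
  rewrite [leRHS](bigID (mem nonvan)) /= lerDl sumr_ge0 // => j _; exact: sqr_ge0.
rewrite parseval // ler_wpM2l //.
have vE : rsq q = s^-1 by [].
have vs : rsq q * s = 1 by rewrite vE mulVf ?gt_eqF.
have v0 := rsq_ge0 R q.
(* With [u = rsq x] and [v = rsq q], the shifted kernel lies between [u - 2 * v] and [u - v]; as
   [v <= u], both squares are at most [u ^+ 2 - 2 * v * u + 2 * v ^+ 2]. *)
apply: (@le_trans _ _ (\sum_(x : F | x != 0) ((x%:R : R)^-1 - 2 * rsq q * rsq x + 2 * rsq q ^+ 2))).
  apply: ler_sum => x x0; have /andP[h1 h2] := kern_Fp_bounds x0.
  have /andP[x1 xq] := val_Fp_bounds q_pr x0.
  have h3 : rsq q <= rsq x by apply: rsq_le => //; exact: ltnW.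
  rewrite -rsq_sqr /f; move: h1 h2 h3 v0; set v := rsq q; set u := rsq x; set k := kern x.
  by move=> *; nra.
rewrite big_split sumrB /= -mulr_sumr.
have -> : \sum_(x : F | x != 0) 2 * rsq q ^+ 2 = 2 * rsq q ^+ 2 * (q.-1)%:R.
  by rewrite -(card_Fp_neq0 R q_pr) mulr_sumr; apply: eq_bigr => *; rewrite mulr1.
have h1 := sum_Fp_inv_le; have h2 := sum_Fp_rsq_ge.
have h3 : rsq q * (2 * s - 2) <= rsq q * \sum_(x : F | x != 0) rsq x by apply: ler_wpM2l.
have h4 : rsq q ^+ 2 * (q.-1)%:R <= 1.
  rewrite natr_pred -s2 mulrBr -exprMn vs expr1n mulr1 gerBl; exact: sqr_ge0.
rewrite -mulrA -[2 * _ * _]mulrA vE in h3 h4 *.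
have e : s^-1 * (2 * s - 2) = 2 - 2 * s^-1 by field; rewrite gt_eqF.
lra.
Qed.

(** Inversion at 1 evaluates the sum over all indices as [(q - 1) * f 1], with [f 1] close to 1; the
    trivial index is removed at a cost of at most [2 * s]. *)
Lemma nonvan_first_moment :
  q%:R - 1 - 4 * s <= normc (\sum_(j in nonvan) Lchi j).
Proof.
pose f (x : F) : R := kern x + - rsq q.
have -> : \sum_(j in nonvan) Lchi j = ((((q.-1)%:R * f 1) - \sum_(x : F | x != 0) f x)%:C)%C.
  rewrite sum_nonvan rmorphB /= -(sum_hat q_pr f) -(hat_triv q_pr f) [in RHS](bigD1 0) //= addrAC subrr add0r.
  by apply: eq_bigr => j j0; rewrite hatD hat_cst // addr0.
rewrite normc_real; apply: le_trans (ler_norm _).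
have v0 := rsq_ge0 R q.
have vs : rsq q * s = 1 by rewrite mulVf ?gt_eqF.
have f1 : 1 - 2 * rsq q <= f 1.
  have /andP[h1 h2] := kern_Fp_bounds (oner_neq0 F).
  have e1 : nat_of_ord (1%R : F) = 1%N := val_Fp_small q_pr (prime_gt1 q_pr).
  by rewrite e1 rsq1 in h1 h2; rewrite /f; lra.
have f2 : \sum_(x : F | x != 0) f x <= 2 * s.
  apply: le_trans sum_Fp_rsq_le; apply: ler_sum => x x0.
  by have /andP[h1 h2] := kern_Fp_bounds x0; rewrite /f; lra.
have q1 : 0 <= (q.-1)%:R :> R by [].
have h := ler_wpM2l q1 f1.
have e : (q.-1)%:R * (1 - 2 * rsq q) >= q%:R - 1 - 2 * s.
  rewrite natr_pred -s2.
  have -> : (s ^+ 2 - 1) * (1 - 2 * rsq q) = s ^+ 2 - 1 - 2 * s * (rsq q * s) + 2 * rsq q by ring.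
  rewrite vs; lra.
lra.
Qed.

(** Cauchy-Schwarz between the two moments. The constant must be 1 because this bound is later
    raised to an unbounded power. *)
Lemma nonvan_card_ge : 40 <= Num.sqrt s -> q%:R / ln q%:R <= #|nonvan|%:R :> R.
Proof.
set y := Num.sqrt s => y40.
have y2 : y ^+ 2 = s by rewrite sqr_sqrtr // ltW.
have s1 : 1600 <= s by rewrite -y2; nra.
have sq : 1600 * s <= q%:R by rewrite -s2 expr2 ler_wpM2r // ltW.
have q1 : 1 < q%:R :> R by lra.
have l0 : 0 < ln (q%:R : R) by apply: ln_gt0.
have ly : ln (q%:R : R) <= 4 * y by apply: ln_le_root4.
have l1 : 1 <= ln (q%:R : R) by apply: ln_ge1; lra.
have cs := sqr_sum_le nonvan (fun j => normc (Lchi j)).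
have m1 := nonvan_first_moment; have m2 := nonvan_second_moment.
have m3 : q%:R - 1 - 4 * s <= \sum_(j in nonvan) normc (Lchi j).
  exact: le_trans m1 (normc_sum _ _ _).
rewrite ler_pdivrMr //.
move: cs m2 m3; rewrite natr_pred.
set A := \sum_(j in _) _ ^+ 2; set B := \sum_(j in _) _; set K := #|_|%:R.
set l := ln _ in l0 ly l1 *.
move=> cs m2 m3.
have K0 : 0 <= K by rewrite ler0n.
have v4 : s * (4 / s) = 4 by field; rewrite gt_eqF.
have v0 : 0 <= 4 / s by rewrite divr_ge0 // ltW.
set v := 4 / s in m2 v4 v0.
have b0 : 0 <= q%:R - 1 - 4 * s by lra.
have h1 : (q%:R - 1 - 4 * s) ^+ 2 <= K * ((q%:R - 1) * (l - 1 + v)).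
  apply: le_trans (_ : B ^+ 2 <= _); first by rewrite ler_sqr ?nnegrE //; exact: le_trans m3.
  by apply: le_trans cs _; exact: ler_wpM2l.
have D0 : 0 < (q%:R - 1) * (l - 1 + v).
  have v1 : 0 < v by rewrite divr_gt0.
  by apply: mulr_gt0; lra.
(* The [-1] beside [l] saves [q ^+ 2], which outweighs the losses of order [l * s * q] because
   [l <= 4 * y] with [y = q^(1/4)] and [s = y ^+ 2]. *)
have h2 : q%:R * ((q%:R - 1) * (l - 1 + v)) <= l * (q%:R - 1 - 4 * s) ^+ 2.
  have c1 : q%:R * ((q%:R - 1) * (l - 1 + v)) <= q%:R ^+ 2 * (l - 1 + v).
    have h : 0 <= q%:R * (l - 1 + v) by apply: mulr_ge0; [exact: ltW|lra].
    have -> : q%:R ^+ 2 * (l - 1 + v) = q%:R * ((q%:R - 1) * (l - 1 + v)) + q%:R * (l - 1 + v) by ring.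
    by rewrite lerDl.
  have c2 : q%:R ^+ 2 * (l - 1 + v) = q%:R * (q%:R * l - q%:R + s * 4).
    by rewrite -v4 -s2; ring.
  have c3 : l * (q%:R * (q%:R - 2 * (1 + 4 * s))) <= l * (q%:R - 1 - 4 * s) ^+ 2.
    apply: ler_wpM2l; first exact: ltW.
    by have := sqr_ge0 (1 + 4 * s); rewrite !expr2; lra.
  apply: le_trans c1 _; rewrite c2; apply: le_trans c3.
  rewrite mulrCA ler_pM2l //.
  suff : 2 * l * (1 + 4 * s) <= q%:R - 4 * s by lra.
  apply: (@le_trans _ _ (8 * y * (1 + 4 * s))).
    by rewrite ler_wpM2r //; lra.
  rewrite -s2 -y2.
  have y0 : 0 <= y by lra.
  have y3 : 40 * y ^+ 3 <= y ^+ 4 by rewrite [leRHS]exprSr mulrC ler_wpM2l ?exprn_ge0.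
  have y4 : 40 * y ^+ 2 <= y ^+ 3 by rewrite [leRHS]exprSr mulrC ler_wpM2l ?exprn_ge0.
  have y5 : 40 * y <= y ^+ 2 by rewrite expr2 ler_wpM2r.
  rewrite -exprM.
  have -> : 8 * y * (1 + 4 * y ^+ 2) = 8 * y + 32 * y ^+ 3 by ring.
  lra.
rewrite -(ler_pM2r D0); apply: le_trans h2 _.
set D := _ * (l - 1 + v) in h1 *; rewrite (_ : _ * _ * D = l * (K * D)); last by ring.
by apply: ler_wpM2l => //; exact: ltW.
Qed.

End Nonvanishing.

(** * The first moment over triples of characters with a given product *)

Lemma sum_even_odd (V : nmodType) (a : nat -> V) q : (0 < q)%N ->
  \sum_(1 <= n < q.*2) a n = \sum_(1 <= n < q) a n.*2 + \sum_(0 <= k < q) a k.*2.+1.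
Proof.
elim: q => [//|[|q] IH] _; first by rewrite big_nat1 big_geq // big_nat1 add0r.
rewrite doubleS big_nat_recr //= big_nat_recr //= IH //.
rewrite [in RHS]big_nat_recr //= [X in _ = _ + X]big_nat_recr //=.
by rewrite -!addrA; congr (_ + _); rewrite addrCA.
Qed.

Section TripleFirstMoment.
Variables (R : realType) (q : nat) (q_pr : prime q).
Local Notation C := (R[i]).
Local Notation F := 'F_q.
Local Notation I := 'I_(q.-2.+1).
Local Notation chi := (@chi R q).
Local Notation kern := (@kern R q).
Local Notation rsq := (@rsq R).

Let q0 : (0 < q)%N. Proof. exact: prime_gt0. Qed.
Let qR : 0 < q%:R :> R. Proof. by rewrite ltr0n. Qed.
Let s := Num.sqrt (q%:R : R).
Let s_gt0 : 0 < s. Proof. by rewrite sqrtr_gt0. Qed.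
Let s2 : s ^+ 2 = q%:R. Proof. by rewrite sqr_sqrtr. Qed.

(** The mean over the units is removed so that the trivial coefficient vanishes; the sum over
    triples can then run over all indices. *)
Definition kern0 (x : F) : R :=
  kern x + - ((\sum_(y : F | y != 0) kern y) / (q.-1)%:R).

Definition Lchi0 (j : I) : C := if j == 0 then 0 else Lchi R j.

Lemma hat_kern0 j : hat kern0 j = Lchi0 j.
Proof.
rewrite /Lchi0; have [->|j0] := eqVneq j 0; last by rewrite hatD hat_cst // addr0.
have n0 : (q.-1)%:R != 0 :> R.
  by rewrite pnatr_eq0 -lt0n -ltnS prednK // prime_gt1.
rewrite hat_triv // big_split /=.
rewrite (_ : \sum_(x : F | x != 0) - _ = - (\sum_(y : F | y != 0) kern y)) ?subrr //.
rewrite sumrN; congr (- _).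
rewrite -[in LHS](mulr1 (_ / _)) -mulr_sumr card_Fp_neq0 //.
by rewrite mulfVK.
Qed.

(* Multiplying by the inverse Euler factor at 2 leaves the odd integers, whose
   contribution beyond 1 is at most [3^(-3/2) + 3^(-1/2) <= 4/5]. *)
Lemma sum_rsq3_chi_ge t :
  10^-1 - rsq q / 2 <= normc (\sum_(x : F | x != 0) ((rsq x ^+ 3)%:C)%C * chi t x).
Proof.
pose a n : C := ((rsq n ^+ 3)%:C)%C * chin R t n.
have aM m n : a (m * n)%N = a m * a n.
  rewrite /a rsqM exprMn rmorphM /chin natrM chiM //; ring.
have na n : normc (a n) <= rsq n ^+ 3.
  rewrite Normc.normcM normc_real ger0_norm ?exprn_ge0 ?rsq_ge0 //.
  rewrite -[leRHS]mulr1 ler_wpM2l ?exprn_ge0 ?rsq_ge0 //; exact: normc_chi_le1.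
have -> : \sum_(x : F | x != 0) ((rsq x ^+ 3)%:C)%C * chi t x = \sum_(1 <= n < q) a n.
  by rewrite -(sum_Fp_neq0 q_pr); apply: eq_bigr => x _; rewrite /a /chin natr_Zp.
set D := \sum_(_ <= _ < _) _.
(* By multiplicativity [a 2 * D] is the sum over even integers below [2 * q]; splitting that range
   by parity leaves the odd integers minus the integers from [q] on. *)
have e : (1 - a 2%N) * D = \sum_(0 <= k < q) a k.*2.+1 - \sum_(q <= n < q.*2) a n.
  have h := sum_even_odd a q0.
  rewrite (@big_cat_nat _ _ _ q) //= in h; last by rewrite -addnn leq_addr.
  rewrite mulrBl mul1r {2}/D mulr_sumr.
  under eq_bigr do rewrite -aM mul2n.
  rewrite (_ : D = \sum_(1 <= n < q) a n) // -/D in h *.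
  by apply/eqP; rewrite subr_eq addrAC eq_sym subr_eq addrC -h.
have odd_part : 1 / 5 <= normc (\sum_(0 <= k < q) a k.*2.+1).
  rewrite big_ltn //= ; set T := \sum_(_ <= _ < _) _.
  have hT : normc T <= 4 / 5.
    apply: le_trans (normc_sum _ _ _) _.
    by apply: le_trans (@sum_rsq3_odd_le R q); apply: ler_sum => k _.
  have a1 : a 1%N = 1 by rewrite /a rsq1 expr1n /chin chi1 // mulr1.
  rewrite a1; have : normc (1 : C) <= normc (1 + T) + normc T.
    rewrite -{1}[1](addrK T) -[in X in _ <= X](normcN T); exact: le_normcD.
  by rewrite Normc.normc1; lra.
have tail : normc (\sum_(q <= n < q.*2) a n) <= rsq q.
  apply: le_trans (normc_sum _ _ _) _.
  apply: (@le_trans _ _ (\sum_(q <= n < q.*2) rsq q ^+ 3)).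
    apply: ler_sum_nat => n /andP[qn _]; apply: le_trans (na n) _.
    by rewrite lerXn2r ?nnegrE ?rsq_ge0 // rsq_le.
  rewrite sumr_const_nat -addnn addnK -mulr_natr exprSr mulrC mulrA rsq_sqr.
  by rewrite divff ?mul1r // gt_eqF.
have n2 : normc (1 - a 2%N) <= 2.
  apply: le_trans (le_normcD _ _) _; rewrite Normc.normc1 normcN.
  have : normc (a 2%N) <= 1.
    apply: le_trans (na _) _; rewrite exprn_ile1 ?rsq_ge0 //.
    by rewrite -rsq1; apply: rsq_le.
  lra.
have h1 : 1 / 5 - rsq q <= normc ((1 - a 2%N) * D).
  rewrite e; set U := \sum_(0 <= _ < _) _ in odd_part *; set V := \sum_(q <= _ < _) _ in tail *.
  have : normc U <= normc (U - V) + normc V by rewrite -{1}[U](subrK V); exact: le_normcD.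
  lra.
rewrite Normc.normcM in h1.
have := ler_wpM2r (normc_ge0 D) n2; lra.
Qed.

Lemma kern0_rsq x : x != 0 -> `|kern0 x - rsq x| <= 5 * rsq q.
Proof.
move=> x0; have /andP[h1 h2] := kern_Fp_bounds R q_pr x0.
have q2 : 2 <= q%:R :> R by rewrite ler_nat prime_gt1.
have p0 : 0 < (q.-1)%:R :> R by rewrite natr_pred //; lra.
set S := \sum_(y : F | y != 0) kern y.
have S1 : S <= 2 * s.
  apply: le_trans (sum_Fp_rsq_le R q_pr); apply: ler_sum => y y0.
  by have /andP[] := kern_Fp_bounds R q_pr y0.
have S0 : 0 <= S.
  apply: sumr_ge0 => y y0; have /andP[h _] := kern_Fp_bounds R q_pr y0.
  apply: le_trans h; rewrite subr_ge0.
  have /andP[y1 yq] := val_Fp_bounds q_pr y0.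
  by apply: rsq_le => //; exact: ltnW.
have m0 : 0 <= S / (q.-1)%:R by rewrite divr_ge0 // ltW.
have m1 : S / (q.-1)%:R <= 4 * rsq q.
  rewrite ler_pdivrMr // natr_pred //; apply: le_trans S1 _.
  have vs : rsq q * s = 1 by rewrite mulVf ?gt_eqF.
  have -> : 4 * rsq q * (q%:R - 1) = 4 * rsq q * (q%:R / 2) + 4 * rsq q * (q%:R / 2 - 1) by field.
  have : 4 * rsq q * (q%:R / 2) = 2 * s.
    have -> : 4 * rsq q * (q%:R / 2) = 2 * (rsq q * s) * s by rewrite -s2; field.
    by rewrite vs mulr1.
  have : 0 <= 4 * rsq q * (q%:R / 2 - 1).
    apply: mulr_ge0; first by rewrite mulr_ge0 ?rsq_ge0.
    lra.
  lra.
have v0 := rsq_ge0 R q.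
by rewrite /kern0 -/S ler_norml; apply/andP; split; lra.
Qed.

Lemma cube_diff_le (h f e : R) : 0 <= h -> `|f - h| <= e ->
  `|f ^+ 3 - h ^+ 3| <= 3 * e * h ^+ 2 + 3 * e ^+ 2 * h + e ^+ 3.
Proof.
move=> h0 he; have d0 := normr_ge0 (f - h).
have -> : f ^+ 3 - h ^+ 3 = 3 * h ^+ 2 * (f - h) + 3 * h * (f - h) ^+ 2 + (f - h) ^+ 3 by ring.
apply: le_trans (ler_normD _ _) _; apply: lerD; last by rewrite normrX lerXn2r ?nnegrE // (le_trans d0).
apply: le_trans (ler_normD _ _) _; apply: lerD.
  rewrite normrM ger0_norm; last by rewrite mulr_ge0 ?sqr_ge0.
  rewrite [leRHS]mulrAC; apply: ler_wpM2l => //; by rewrite mulr_ge0 ?sqr_ge0.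
rewrite normrM normrX ger0_norm; last by rewrite mulr_ge0.
rewrite [leRHS]mulrAC; apply: ler_wpM2l; first by rewrite mulr_ge0.
by rewrite lerXn2r ?nnegrE // (le_trans d0).
Qed.

(** By [conv3] this is a character sum of [kern0 ^+ 3], compared with that of [rsq ^+ 3]. The main
    term is at least [1/10] up to [rsq q / 2]; this loss and the comparison error are each at most
    [1/40], which leaves [1/20]. *)
Lemma triple_first_moment t : 10 ^+ 4 <= Num.sqrt s ->
  (q.-1)%:R ^+ 2 / 20 <=
    normc (\sum_i \sum_j Lchi0 i * Lchi0 j * Lchi0 (t - i - j)).
Proof.
set y := Num.sqrt s => y1.
under [X in normc X]eq_bigr do under eq_bigr do rewrite -!hat_kern0.
rewrite conv3 // Normc.normcM normcX -(rmorph_nat (real_complex R)) normc_real normr_nat.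
rewrite ler_wpM2l ?sqr_ge0 //.
set S := \sum_(z : F | _) _.
have D0 := sum_rsq3_chi_ge t; set D := \sum_(x : F | _) _ in D0.
have v0 := rsq_ge0 R q; set v := rsq q in D0 v0.
have vs : v * s = 1 by rewrite mulVf ?gt_eqF.
have vq : v ^+ 2 * q%:R = 1 by rewrite -s2 -exprMn vs expr1n.
have SD : normc (D - S) <= v * (290 + 15 * ln q%:R).
  rewrite -sumrB; apply: le_trans (normc_sum _ _ _) _.
  (* This is [cube_diff_le] with error [5 * v]. The three sums are at most [15 * v * (1 + ln q)],
     [150 * v] and [125 * v], whence 290 and 15. *)
  apply: (@le_trans _ _ (\sum_(x : F | x != 0) (15 * v * (x%:R : R)^-1 + 75 * v ^+ 2 * rsq x + 125 * v ^+ 3))).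
    apply: ler_sum => x x0; rewrite -mulrBl -rmorphB Normc.normcM normc_real normc_chi // mulr1.
    have := cube_diff_le (rsq_ge0 R x) (kern0_rsq x0).
    rewrite distrC -/v rsq_sqr => h; apply: le_trans h _; rewrite le_eqVlt; apply/orP; left; apply/eqP; ring.
  rewrite !big_split /=.
  have -> : \sum_(i : F | i != 0) 125 * v ^+ 3 = 125 * v ^+ 3 * (q.-1)%:R.
    by rewrite -(card_Fp_neq0 R q_pr) mulr_sumr; apply: eq_bigr => *; rewrite mulr1.
  rewrite -!mulr_sumr.
  have h1 := ler_wpM2l v0 (sum_Fp_inv_le R q_pr).
  have v20 : 0 <= v ^+ 2 by exact: sqr_ge0.
  have h2 := ler_wpM2l v20 (sum_Fp_rsq_le R q_pr).
  have h3 : v ^+ 3 * (q.-1)%:R <= v.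
    rewrite natr_pred // mulrBr mulr1 exprSr -mulrA [v * q%:R]mulrC mulrA vq mul1r.
    by rewrite gerBl mulr_ge0.
  rewrite -/s in h2.
  have e2 : v ^+ 2 * (2 * s) = 2 * v by rewrite -[RHS]mulr1 -vs; ring.
  rewrite e2 in h2.
  move: h1 h2 h3; set A := \sum_(x : F | x != 0) (x%:R : R)^-1.
  set B := \sum_(x : F | x != 0) rsq x; set E := (q.-1)%:R; set l := ln _ => h1 h2 h3.
  have -> : 15 * v * A + 75 * v ^+ 2 * B + 125 * v ^+ 3 * E =
    15 * (v * A) + 75 * (v ^+ 2 * B) + 125 * (v ^+ 3 * E) by ring.
  by move: h1; rewrite !mulrDr mulr1; lra.
have ly : ln (q%:R : R) <= 4 * y by apply: ln_le_root4.
have y2 : y ^+ 2 = s by rewrite sqr_sqrtr // ltW.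
have small : v * (290 + 15 * ln q%:R) <= 40^-1.
  have y0 : 0 < y by apply: lt_le_trans y1; rewrite exprn_gt0.
  have yy : v * y * y = 1 by rewrite -mulrA -expr2 y2.
  have vy0 : 0 <= v * y by rewrite mulr_ge0 // ltW.
  have vy : v * y * 10 ^+ 4 <= 1 by rewrite -{2}yy; apply: ler_wpM2l.
  have v1 : v * 10 ^+ 4 <= v * y by apply: ler_wpM2l.
  have := ler_wpM2l v0 ly; move: vy v1; rewrite !exprS expr0.
  set a := v * y; have -> : v * (4 * y) = 4 * a by rewrite /a; ring.
  set b := v * ln _ => *.
  have -> : v * (290 + 15 * ln q%:R) = 290 * v + 15 * b by rewrite /b; ring.
  lra.
have v2 : v / 2 <= 40^-1.
  apply: le_trans small; apply: ler_wpM2l => //.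
  have : 0 <= ln (q%:R : R) by apply: ln_ge0; rewrite ler1n.
  lra.
have : normc D <= normc (D - S) + normc S by rewrite -{1}[D](subrK S); exact: le_normcD.
lra.
Qed.

End TripleFirstMoment.

(** * Absolute residues and the structure of short points *)

Section AbsoluteResidue.
Variables (q : nat) (q_pr : prime q).
Local Notation F := 'F_q.
Implicit Types x y b : F.

(** The distance from [x] to 0 on the circle of residues mod [q]. *)
Definition absq x : nat := minn x (q - x).

Lemma ltn_Fp x : (x < q)%N.
Proof. by have := ltn_ord x; rewrite {2}(Fp_cast q_pr). Qed.

Lemma Fp_nat_neq0 n : (0 < n < q)%N -> (n%:R : F) != 0.
Proof.
move=> /andP[n0 nq]; rewrite -(dvdn_pcharf (pchar_Fp q_pr)).
by apply/negP => /(dvdn_leq n0); rewrite leqNgt nq.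
Qed.

Lemma absq_nat_le n : (absq n%:R <= n)%N.
Proof. by rewrite /absq val_Fp_nat // (leq_trans (geq_minl _ _)) // leq_mod. Qed.

Lemma natr_subq x : ((q - x)%N%:R : F) = - x.
Proof.
have e : ((q - x)%N%:R : F) + (x : nat)%:R = 0.
  by rewrite -natrD subnK ?(ltnW (ltn_Fp x)) // pchar_Fp_0.
by apply/eqP; rewrite -addr_eq0 -[X in _ + X]natr_Zp e.
Qed.

Lemma absqP x : x = (absq x)%:R \/ x = - (absq x)%:R.
Proof.
rewrite /absq; have [h|h] := leqP x (q - x)%N; first by left; rewrite natr_Zp.
by right; rewrite natr_subq opprK.
Qed.

Lemma absqN x : absq (- x) = absq x.
Proof.
have H y : (absq (- y) <= absq y)%N.
  rewrite {2}/absq leq_min; apply/andP; split; last first.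
    by rewrite -natr_subq absq_nat_le.
  have [->|y0] := eqVneq y 0; first by rewrite oppr0 geq_minl.
  have y1 : (0 < y)%N by rewrite lt0n.
  have hy : (q - y < q)%N by rewrite ltn_subrL y1 prime_gt0.
  by rewrite -natr_subq /absq val_Fp_small // geq_min subKn ?leqnn ?orbT // ltnW // ltn_Fp.
by apply/eqP; rewrite eqn_leq H -{1}[x]opprK H.
Qed.

Lemma absq_le_half x : (2 * absq x <= q)%N.
Proof. by rewrite /absq; have := ltn_Fp x; lia. Qed.

Lemma absq_lt x : (absq x < q)%N.
Proof. exact: leq_ltn_trans (geq_minl _ _) (ltn_Fp x). Qed.

Lemma absq_gt0 x : (0 < absq x)%N = (x != 0).
Proof.
have [->|x0] := eqVneq x 0; first by rewrite /absq min0n.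
by rewrite /absq leq_min lt0n x0 subn_gt0 ltn_Fp.
Qed.

Lemma absq_natB m n : (n <= m)%N -> (absq (m%:R - n%:R)%R <= m - n)%N.
Proof. by move=> h; rewrite -natrB // absq_nat_le. Qed.

Lemma absq_fiber_card n : (#|[set x : F | absq x == n]| <= 2)%N.
Proof.
have h : [set x : F | absq x == n] \subset [set (n%:R : F); - (n%:R : F)].
  apply/fintype.subsetP => x; rewrite !inE => /eqP <-.
  by case: (absqP x) => /eqP ->; rewrite ?orbT.
by apply: leq_trans (subset_leq_card h) _; rewrite cards2; case: eqP.
Qed.

Lemma absq_mul_eq x y x' y' : x * y = x' * y' ->
  ((absq x * absq y)%N%:R = (absq x' * absq y')%N%:R :> F) \/
  ((absq x * absq y + absq x' * absq y')%N%:R = 0 :> F).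
Proof.
move=> e; rewrite natrD !natrM; move: e.
have := absqP y'; have := absqP x'; have := absqP y; have := absqP x.
move: (absq x)%:R (absq y)%:R (absq x')%:R (absq y')%:R => a b c d.
case=> ->; case=> ->; case=> ->; case=> ->; rewrite ?mulrNN ?mulrN ?mulNr ?opprK => e;
  by [left | left; apply: oppr_inj | right; rewrite e addNr | right; rewrite -e subrr
     | right; rewrite e subrr | right; rewrite -e addNr].
Qed.

Definition sgq x : bool := (x <= q - x)%N.

Lemma absq_sub_lt x y (B : nat) : (0 < B)%N -> sgq x = sgq y ->
  (absq x %/ B = absq y %/ B)%N -> (absq (x - y)%R < B)%N.
Proof.
move=> B0 sxy cxy.
have key (m n : nat) : (m %/ B = n %/ B)%N -> (absq (m%:R - n%:R)%R < B)%N.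
  move=> e; have hm := ltn_ceil m B0; have hn := ltn_ceil n B0.
  have lm := leq_trunc_div m B; have ln := leq_trunc_div n B.
  have [h|h] := leqP n m.
    by apply: leq_ltn_trans (absq_natB h) _; rewrite e in hm lm; rewrite mulSn in hm; lia.
  rewrite -absqN opprB; apply: leq_ltn_trans (absq_natB (ltnW h)) _.
  by rewrite -e in hn ln; rewrite mulSn in hn; lia.
have := key _ _ cxy; move: sxy; rewrite /sgq /absq.
have [h|h] := leqP x (q - x)%N; have [h'|h'] := leqP y (q - y)%N => // _.
  by rewrite !natr_Zp.
have e : ((q - x)%N%:R : F) - (q - y)%N%:R = - (x - y).
  by rewrite !natr_subq opprB opprK addrC.
by rewrite e -!/(absq _) absqN.
Qed.

Variable B : nat.
Hypothesis B_gt0 : (0 < B)%N.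
Hypothesis B_le : (4 * B ^ 2 <= q)%N.

Definition short (z : F) : {set F} :=
  [set b | [&& b != 0%R, (absq b < B)%N & (absq (z * b)%R < B)%N]].

(* Two short points satisfy [b c' = +- b' c] mod q, and both sides are below
   [q / 2] in absolute value, so the congruence is an equality. *)
Lemma short_proportional z b b' : z != 0 -> b \in short z -> b' \in short z ->
  (absq b * absq (z * b')%R = absq b' * absq (z * b)%R)%N.
Proof.
move=> z0; rewrite !inE => /and3P[b0 b1 b2] /and3P[b0' b1' b2'].
have e : b * (z * b') = b' * (z * b) by rewrite mulrCA [RHS]mulrCA [b * b']mulrC.
have c0 : (0 < absq b * absq (z * b')%R)%N by rewrite muln_gt0 !absq_gt0 b0 mulf_neq0.
have u1 : (absq b * absq (z * b')%R < B ^ 2)%N by rewrite -mulnn ltn_mul.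
have u2 : (absq b' * absq (z * b)%R < B ^ 2)%N by rewrite -mulnn ltn_mul.
have := absq_mul_eq e; move: c0 u1 u2.
set m1 := absq b; set m2 := absq (z * b'); set m3 := absq b'; set m4 := absq (z * b).
move=> c0 u1 u2.
have lt_q k : (k < 2 * B ^ 2)%N -> (k < q)%N by move=> h; lia.
case=> /(congr1 (fun x : F => x : nat)); rewrite !val_Fp_small //; try (apply: lt_q; lia).
by move=> /= h; lia.
Qed.

(** Dividing one short pair by its gcd gives coprime [r] and [s]. Every other pair is proportional
    to it by [short_proportional], so Gauss's lemma makes [r] divide [absq b], and the quotient is
    the multiplier [k]. *)
Lemma short_structure z : z != 0 -> short z = finset.set0 \/
  exists r s : nat, [/\ (0 < r < B)%N, (0 < s < B)%N,
    z * r%:R = s%:R \/ z * r%:R = - s%:R &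
    forall b, b \in short z -> exists k, [/\ (0 < k < B)%N, absq b = (k * r)%N &
      absq (z * b)%R = (k * s)%N]].
Proof.
move=> z0; have [->|/set0Pn[b0 hb0]] := eqVneq (short z) finset.set0; [by left|right].
have := hb0; rewrite inE => /and3P[b0n b1 b2].
set m := absq b0 in b1; set n := absq (z * b0) in b2.
have m0 : (0 < m)%N by rewrite absq_gt0.
have n0 : (0 < n)%N by rewrite absq_gt0 mulf_neq0.
have g0 : (0 < gcdn m n)%N by rewrite gcdn_gt0 m0.
have hm : m = ((m %/ gcdn m n) * gcdn m n)%N by rewrite divnK // dvdn_gcdl.
have hn : n = ((n %/ gcdn m n) * gcdn m n)%N by rewrite divnK // dvdn_gcdr.
set g := gcdn m n in g0 hm hn; set r := (m %/ g)%N in hm; set s := (n %/ g)%N in hn.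
have r0 : (0 < r)%N by move: m0; rewrite hm muln_gt0 => /andP[].
have s0 : (0 < s)%N by move: n0; rewrite hn muln_gt0 => /andP[].
have rm : (r <= m)%N by rewrite hm leq_pmulr.
have sn : (s <= n)%N by rewrite hn leq_pmulr.
have rs : coprime r s.
  have : (gcdn r s * g = g)%N by rewrite muln_gcdl -hm -hn.
  by rewrite -{2}[g]mul1n => /eqP; rewrite eqn_pmul2r.
exists r, s; split.
- by rewrite r0 (leq_ltn_trans rm).
- by rewrite s0 (leq_ltn_trans sn).
- have gF : (g%:R : F) != 0.
    apply: Fp_nat_neq0; rewrite g0; apply: leq_ltn_trans (absq_lt b0).
    exact: dvdn_leq (dvdn_gcdl _ _).
  have := absqP b0; have := absqP (z * b0); rewrite -/m -/n hm hn !natrM.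
  set R0 := r%:R; set S0 := s%:R; set G0 := g%:R in gF *.
  case=> h1; case=> h2; rewrite h2 in h1.
  + by left; apply: (mulIf gF); rewrite -mulrA.
  + by right; apply: (mulIf gF); rewrite mulNr -h1 mulrN opprK mulrA.
  + by right; apply: (mulIf gF); rewrite mulNr -h1 mulrA.
  + by left; apply: (mulIf gF); apply: oppr_inj; rewrite -h1 mulrN mulrA.
move=> b hb; have := short_proportional z0 hb hb0; rewrite -/m -/n.
have := hb; rewrite inE => /and3P[bn c1 c2].
rewrite {1}hn {1}hm mulnA [RHS]mulnAC => /eqP; rewrite eqn_pmul2r // => /eqP e.
have d : (r %| absq b)%N.
  by rewrite -(Gauss_dvdl _ rs) e dvdn_mulr.
have hk := divnK d; set k := (absq b %/ r)%N in hk.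
have k0 : (0 < k)%N by have : (0 < absq b)%N by [rewrite absq_gt0]; rewrite -hk muln_gt0 => /andP[].
exists k; split; last first.
- move/eqP: e; rewrite -hk mulnAC mulnC eqn_pmul2l // => /eqP <-; exact: erefl.
- by [].
by rewrite k0 (leq_ltn_trans _ c1) // -hk leq_pmulr.
Qed.

End AbsoluteResidue.

(** * The autocorrelation of the short weight *)

Section Autocorrelation.
Variables (R : realType) (q : nat) (q_pr : prime q) (B : nat).
Hypothesis B_gt0 : (0 < B)%N.
Hypothesis B_le : (4 * B ^ 2 <= q)%N.
Local Notation F := 'F_q.
Local Notation rsq := (@rsq R).
Implicit Types (x y z b : F).

Definition wshort x : R := if (absq x < B)%N then rsq (absq x) else 0.
(** Continues [wshort]: it equals [rsq B] at [absq x = B] and then decays like the inverse square,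
    as two summations by parts give. *)
Definition wlong x : R :=
  if (B <= absq x)%N then B%:R * Num.sqrt B%:R / (absq x)%:R ^+ 2 else 0.
Definition harm : R := \sum_(1 <= k < B) (k%:R)^-1.

Lemma wshort_ge0 x : 0 <= wshort x.
Proof. by rewrite /wshort; case: ifP => // _; exact: rsq_ge0. Qed.

Lemma wlong_ge0 x : 0 <= wlong x.
Proof.
by rewrite /wlong; case: ifP.
Qed.

Lemma acorr_ge0 (f : F -> R) z : (forall x, 0 <= f x) -> 0 <= acorr f z.
Proof. by move=> h; apply: sumr_ge0 => y _; rewrite mulr_ge0. Qed.

Lemma harm_ge0 : 0 <= harm.
Proof. by apply: sumr_ge0 => k _; rewrite invr_ge0. Qed.

Lemma acorr_wshort z :
  acorr wshort z = \sum_(b in short B z) rsq (absq (z * b)) * rsq (absq b).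
Proof.
rewrite /acorr (bigID (fun b => b \in short B z)) /= [X in _ + X]big1 ?addr0.
  apply: eq_big => [b|b /andP[_]]; first by rewrite inE; case: (b == 0).
  by rewrite inE /wshort => /and3P[_ -> ->].
move=> b /andP[b0]; rewrite inE b0 /= negb_and /wshort.
by case/orP => /negPf ->; rewrite ?mulr0 ?mul0r.
Qed.

(** Each short point contributes at least [rsq B ^+ 2 = 1 / B] to the autocorrelation. *)
Lemma card_short_le z : z != 0 -> #|short B z|%:R <= B%:R * acorr wshort z.
Proof.
move=> z0; rewrite acorr_wshort mulr_sumr -[X in X%:R]sum1_card natr_sum.
apply: ler_sum => b; rewrite inE => /and3P[b0 h1 h2].
have B1 : B%:R * (rsq B * rsq B) = 1 :> R.
  by rewrite -expr2 rsq_sqr divff // pnatr_eq0 -lt0n.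
apply: (@le_trans _ _ (B%:R * (rsq B * rsq B))); first by rewrite B1.
apply: ler_wpM2l => //; apply: ler_pM; rewrite ?rsq_ge0 //.
  by rewrite rsq_le ?(ltnW h2) // absq_gt0 ?mulf_neq0.
by rewrite rsq_le ?(ltnW h1) // absq_gt0.
Qed.

(** The pair with multiplier [k] contributes [rsq r * rsq s / k], and at most two points [b] share
    the value [absq b = k * r]; summing over [k] gives [2 * harm]. *)
Lemma acorr_wshort_le z : z != 0 -> acorr wshort z = 0 \/
  exists r s : nat, [/\ (0 < r < B)%N, (0 < s < B)%N,
    z * r%:R = s%:R \/ z * r%:R = - s%:R &
    acorr wshort z <= 2 * harm * (rsq r * rsq s)].
Proof.
move=> z0; rewrite acorr_wshort.
case: (short_structure q_pr B_gt0 B_le z0) => [->|[r [s [hr hs zrs H]]]].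
  by left; rewrite big1 // => b; rewrite finset.in_set0.
right; exists r, s; split => //.
have r0 : (0 < r)%N by case/andP: hr.
pose P k b := absq b == (k * r)%N.
apply: (@le_trans _ _ (\sum_(b in short B z) \sum_(1 <= k < B) if P k b then rsq r * rsq s / k%:R else 0)).
  apply: ler_sum => b /H[k [hk e1 e2]].
  rewrite (bigD1_seq k) ?iota_uniq ?mem_index_iota //= /P ?e1 ?eqxx //.
  rewrite e2 !rsqM -[leLHS]addr0 lerD //.
    rewrite -(@rsq_sqr R k) le_eqVlt; apply/orP; left; apply/eqP; ring.
  apply: sumr_ge0 => i _; case: ifP => // _.
  by rewrite mulr_ge0 ?invr_ge0 // mulr_ge0 ?rsq_ge0.
rewrite exchange_big /= [2 * harm]mulrC -mulrA mulr_suml; apply: ler_sum => k _.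
rewrite -big_mkcondr /= sumr_const -[leLHS]mulr_natl.
have h : (#|[pred b | (b \in short B z) && P k b]| <= 2)%N.
  apply: leq_trans (@absq_fiber_card q q_pr (k * r)); apply: subset_leq_card.
  by apply/fintype.subsetP => b; rewrite !inE => /andP[].
have h2 : #|[pred b | (b \in short B z) && P k b]|%:R <= 2 :> R by rewrite ler_nat.
rewrite [leRHS]mulrCA [X in _ <= 2 * X]mulrC; apply: ler_wpM2r => //.
by rewrite mulr_ge0 ?invr_ge0 // mulr_ge0 ?rsq_ge0.
Qed.

(** Each [(r, s)] serves at most the two values [z = s / r] and [z = - s / r], so the sum over [z]
    becomes one over [(r, s)]. The constant is [144 = 2 * 2^3 * 3 * 3], each 3 being the bound of
    [sum_rsq3_le]. *)
Lemma sum_acorr_wshort3 :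
  \sum_(z : F | z != 0) acorr wshort z ^+ 3 <= 144 * harm ^+ 3.
Proof.
pose P (r s : nat) z := (z * r%:R == s%:R) || (z * r%:R == - s%:R).
pose T (r s : nat) : R := (2 * harm) ^+ 3 * (rsq r ^+ 3 * rsq s ^+ 3).
have T0 r s : 0 <= T r s.
  by rewrite !mulr_ge0 ?exprn_ge0 ?mulr_ge0 ?rsq_ge0 ?harm_ge0.
apply: (@le_trans _ _ (\sum_(z : F | z != 0) \sum_(1 <= r < B) \sum_(1 <= s < B) if P r s z then T r s else 0)).
  apply: ler_sum => z z0.
  case: (acorr_wshort_le z0) => [->|[r [s [hr hs zrs h]]]].
    by rewrite expr0n /=; do 2 (apply: sumr_ge0 => ? _); case: ifP.
  rewrite (bigD1_seq r) ?iota_uniq ?mem_index_iota //=.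
  rewrite (bigD1_seq s) ?iota_uniq ?mem_index_iota //= ifT; last first.
    by rewrite /P; case: zrs => ->; rewrite eqxx ?orbT.
  apply: (@le_trans _ _ (T r s)).
    rewrite /T -!exprMn lerXn2r ?nnegrE //; first by apply: acorr_ge0; exact: wshort_ge0.
    by apply: le_trans h; apply: acorr_ge0; exact: wshort_ge0.
  rewrite -addrA lerDl addr_ge0 //; first by apply: sumr_ge0 => ? _; case: ifP.
  by do 2 (apply: sumr_ge0 => ? _); case: ifP.
rewrite exchange_big /=.
apply: (@le_trans _ _ (\sum_(1 <= r < B) \sum_(1 <= s < B) 2 * T r s)).
  apply: ler_sum_nat => r /andP[r0 rB].
  rewrite exchange_big /=; apply: ler_sum => s _.
  rewrite -big_mkcondr /= sumr_const -[leLHS]mulr_natl; apply: ler_wpM2r => //.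
  rewrite ler_nat.
  have rF : (r%:R : F) != 0.
    apply: Fp_nat_neq0 => //; rewrite r0 /=.
    by apply: leq_trans rB (leq_trans _ B_le); rewrite mulnC -mulnn -mulnA leq_pmulr // muln_gt0 B_gt0.
  have h : [set z : F | (z != 0) && P r s z]%SET \subset [set (s%:R / r%:R : F); - (s%:R / r%:R : F)]%SET.
    apply/fintype.subsetP => z; rewrite !inE => /andP[_].
    case/orP => /eqP e; apply/orP; [left|right]; apply/eqP; apply: (mulIf rF).
      by rewrite e divfK.
    by rewrite e mulNr divfK.
  rewrite -[X in (X <= _)%N]cardsE.
  by apply: leq_trans (subset_leq_card h) _; rewrite cards2; case: eqP.
have e : \sum_(1 <= r < B) \sum_(1 <= s < B) 2 * T r s =
   16 * harm ^+ 3 * ((\sum_(1 <= r < B) rsq r ^+ 3) * (\sum_(1 <= s < B) rsq s ^+ 3)).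
  rewrite mulr_suml mulr_sumr; apply: eq_bigr => r _.
  rewrite !mulr_sumr; apply: eq_bigr => s _; rewrite /T; ring.
rewrite e; have h3 := @sum_rsq3_le R B; set S := \sum_(_ <= _ < _) _ in h3 *.
have S0 : 0 <= S by apply: sumr_ge0 => r _; rewrite exprn_ge0 ?rsq_ge0.
have SS : S * S <= 9 by nra.
have H0 : 0 <= 16 * harm ^+ 3 by rewrite mulr_ge0 ?exprn_ge0 ?harm_ge0.
apply: le_trans (ler_wpM2l H0 SS) _; lra.
Qed.

End Autocorrelation.

(** * The long weight, covered by cells of side [B] *)

Section LongAutocorrelation.
Variables (R : realType) (q : nat) (q_pr : prime q) (B : nat).
Hypothesis B_gt0 : (0 < B)%N.
Hypothesis B_le : (4 * B ^ 2 <= q)%N.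
Local Notation F := 'F_q.
Local Notation rsq := (@rsq R).
Local Notation wshort := (@wshort R q B).
Local Notation wlong := (@wlong R q B).
Implicit Types (x y z b : F).

(* In a cell of side [B] with fixed signs, differences of points are short. *)
Lemma card_cell_le z (i j : nat) :
  (#|[set y : F | (absq y %/ B == i)%N && (absq (z * y)%R %/ B == j)%N]%SET|
    <= 4 * (#|short B z| + 1))%N.
Proof.
set Y := finset _; rewrite -sum1_card.
(* The four sign patterns give the factor 4; within one of them, translation by a fixed point embeds
   the cell into [short B z] together with 0. *)
rewrite (partition_big (fun y => (sgq y, sgq (z * y))) predT) //=.
apply: leq_trans (_ : \sum_(p : bool * bool) (#|short B z| + 1) <= _)%N; last first.
  by rewrite sum_nat_const card_prod !card_bool.
apply: leq_sum => p _; rewrite sum1_card.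
set K := (X in #|X|).
have inK y : y \in K = [&& absq y %/ B == i, absq (z * y)%R %/ B == j & (sgq y, sgq (z * y)%R) == p]%N.
  by rewrite -[y \in K]/((y \in Y) && ((sgq y, sgq (z * y)) == p)) /Y inE -andbA.
have [y0 hy0|K0] := pickP K; last by rewrite (eq_card0 K0).
have h : [set y - y0 | y in K] \subset 0 |: short B z.
  apply/fintype.subsetP => b /imsetP[y hy ->]; rewrite !inE.
  have [//|n0] := eqVneq (y - y0) 0; rewrite /= mulrBr.
  move: hy hy0; rewrite -[K y0]/(y0 \in K) !inK => /and3P[/eqP c1 /eqP c2 /eqP s1].
  move=> /and3P[/eqP d1 /eqP d2 /eqP s2].
  move: s1; rewrite -s2 => -[e1 e2].
  by rewrite !absq_sub_lt // ?c1 ?d1 // c2 d2.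
rewrite -(card_imset K (addIr (- y0))).
apply: leq_trans (subset_leq_card h) _; rewrite cardsU1 addnC leq_add2l.
by case: (_ \notin _).
Qed.

Lemma wlong_le b : wlong b <= \sum_(1 <= i < q) (if (absq b %/ B == i)%N then rsq B * (i%:R ^+ 2)^-1 else 0).
Proof.
have pos i : 0 <= (if (absq b %/ B == i)%N then rsq B * (i%:R ^+ 2)^-1 else 0).
  by case: ifP => // _; rewrite mulr_ge0 ?rsq_ge0 // invr_ge0 sqr_ge0.
rewrite /wlong; case: ifP => hB; last by apply: sumr_ge0 => i _.
have i0 : (0 < absq b %/ B)%N by rewrite divn_gt0.
have iq : (absq b %/ B < q)%N by apply: leq_ltn_trans (leq_div _ _) (absq_lt q_pr b).
rewrite (bigD1_seq (absq b %/ B)%N) ?iota_uniq ?mem_index_iota ?i0 //= eqxx.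
rewrite -[leLHS]addr0 lerD //; last by apply: sumr_ge0 => i _.
set i := (_ %/ _)%N in i0 *.
have h : (i * B <= absq b)%N by exact: leq_trunc_div.
have hR : i%:R * B%:R <= (absq b)%:R :> R by rewrite -natrM ler_nat.
have iR : 0 < i%:R :> R by rewrite ltr0n.
have BR : 0 < B%:R :> R by rewrite ltr0n.
have e : rsq B = B%:R * Num.sqrt B%:R / B%:R ^+ 2.
  have s0 : 0 < Num.sqrt (B%:R : R) by rewrite sqrtr_gt0.
  have s2 := sqrtn_sqr R B.
  rewrite /rsq -{2 4}s2; field; exact: lt0r_neq0.
have -> : rsq B * (i%:R ^+ 2)^-1 = B%:R * Num.sqrt B%:R / (i%:R * B%:R) ^+ 2.
  by rewrite e; field; rewrite !lt0r_neq0.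
apply: ler_wpM2l; first by rewrite mulr_ge0 ?sqrtr_ge0.
rewrite lef_pV2 ?posrE ?exprn_gt0 ?mulr_gt0 //; last by apply: lt_le_trans hR; rewrite mulr_gt0.
by rewrite lerXn2r ?nnegrE // mulr_ge0.
Qed.

(** Cell [(i, j)] holds at most [4 * (n + 1)] points, each of weight at most [1 / (B * i^2 * j^2)].
    The two sums of inverse squares are at most 2 each, which gives 16, and [n / B] is at most
    [acorr wshort z] by [card_short_le]. *)
Lemma acorr_wlong_le z : z != 0 ->
  acorr wlong z <= 16 * (acorr wshort z + B%:R^-1).
Proof.
move=> z0.
pose c (i : nat) : R := (i%:R ^+ 2)^-1.
have c0 i : 0 <= c i by rewrite invr_ge0 sqr_ge0.
pose P i j y := (absq y %/ B == i)%N && (absq (z * y)%R %/ B == j)%N.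
have BR : 0 < B%:R :> R by rewrite ltr0n.
have r2 : rsq B * rsq B = B%:R^-1 by rewrite -expr2 rsq_sqr.
apply: (@le_trans _ _ (\sum_(y : F | y != 0) \sum_(1 <= j < q) \sum_(1 <= i < q)
    (if P i j y then B%:R^-1 * (c i * c j) else 0))).
  apply: ler_sum => y y0; apply: le_trans (ler_pM _ _ (wlong_le _) (wlong_le _)) _;
    rewrite ?wlong_ge0 //.
  rewrite mulr_suml; apply: ler_sum => j _; rewrite mulr_sumr; apply: ler_sum => i _.
  rewrite /P; case: ifP => _; case: ifP => _ /=; rewrite ?mulr0 ?mul0r //.
  by rewrite -r2 le_eqVlt; apply/orP; left; apply/eqP; rewrite /c; ring.
rewrite exchange_big /=; under eq_bigr do rewrite exchange_big /=.
set n := #|short B z|.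
apply: (@le_trans _ _ (\sum_(1 <= j < q) \sum_(1 <= i < q)
     4 * (n%:R + 1) * (B%:R^-1 * (c i * c j)))).
  apply: ler_sum => j _; apply: ler_sum => i _.
  rewrite -big_mkcondr /= sumr_const -[leLHS]mulr_natl; apply: ler_wpM2r.
    by rewrite !mulr_ge0 // invr_ge0 ltW.
  rewrite -[1]/(1%:R) -natrD -natrM ler_nat; apply: leq_trans (card_cell_le z i j).
  by apply: subset_leq_card; apply/fintype.subsetP => y; rewrite !inE => /andP[].
have -> : \sum_(1 <= j < q) \sum_(1 <= i < q) 4 * (n%:R + 1) * (B%:R^-1 * (c i * c j)) =
   4 * (n%:R + 1) * B%:R^-1 * ((\sum_(1 <= i < q) c i) * (\sum_(1 <= j < q) c j)).
  rewrite mulr_suml mulr_sumr; apply: eq_bigr => j _.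
  rewrite !mulr_sumr; apply: eq_bigr => i _; ring.
have h2 : \sum_(1 <= i < q) c i <= 2 by exact: sum_invsq_le.
set S := \sum_(1 <= i < q) c i in h2 *.
have S0 : 0 <= S by apply: sumr_ge0.
have SS : S * S <= 4 by nra.
have n1 : 0 <= n%:R + 1 :> R by rewrite addr_ge0.
have p0 : 0 <= 4 * (n%:R + 1) / B%:R :> R by rewrite divr_ge0 ?mulr_ge0 ?ltW.
apply: le_trans (ler_wpM2l p0 SS) _.
have h := card_short_le R q_pr B_gt0 z0; rewrite -/n in h.
have h3 : n%:R / B%:R <= acorr wshort z by rewrite ler_pdivrMr // mulrC.
have -> : 4 * (n%:R + 1) / B%:R * 4 = 16 * (n%:R / B%:R + B%:R^-1) :> R by field; exact: lt0r_neq0.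
by rewrite ler_pM2l // lerD2r.
Qed.

(** Cross-correlations of [f] and [g] are avoided by passing to the spectral side, where
    [|hat f + hat g|^2] is at most [2 |hat f|^2 + 2 |hat g|^2], and returning by [conv3_le]. *)
Lemma sum_acorrD3_le (f g : F -> R) :
  \sum_(z : F | z != 0) acorr (fun x => f x + g x) z ^+ 3 <=
  \sum_(z : F | z != 0) `|2 * acorr f z + 2 * acorr g z| ^+ 3.
Proof.
pose w x := f x + g x.
pose A (j : 'I_(q.-2.+1)) : R := normc (hat w j) ^+ 2.
pose U (j : 'I_(q.-2.+1)) : R := 2 * normc (hat f j) ^+ 2 + 2 * normc (hat g j) ^+ 2.
have AU j : 0 <= A j <= U j.
  rewrite sqr_ge0 /A /U /w hatD /=.
  exact: normcD_sqr_le.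
have hU j : hat (fun z => 2 * acorr f z + 2 * acorr g z) j = ((U j)%:C)%C.
  by rewrite hatD !hatZ !hat_acorr // -!rmorphM -rmorphD.
have := conv3_le q_pr 0 AU hU.
have -> : \sum_i \sum_j A i * A j * A (0 - i - j) =
   (q.-1)%:R ^+ 2 * \sum_(z : F | z != 0) acorr w z ^+ 3.
  have e1 : ((\sum_(z : F | z != 0) acorr w z ^+ 3)%:C)%C =
      \sum_(z : F | z != 0) ((acorr w z ^+ 3)%:C)%C * chi R 0 z.
    by rewrite rmorph_sum; apply: eq_bigr => z z0; rewrite chi_triv // mulr1.
  apply: complexI; rewrite rmorph_sum rmorphM /= e1 rmorphXn rmorph_nat.
  rewrite -conv3 //; apply: eq_bigr => i _; rewrite rmorph_sum; apply: eq_bigr => j _.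
  by rewrite !hat_acorr // !rmorphM.
rewrite ler_pM2l // exprn_gt0 // ltr0n -ltnS prednK ?prime_gt0 // prime_gt1 //.
Qed.

Definition wfull x : R := wshort x + wlong x.

Lemma sum_acorr_wfull3 : (q < 16 * B ^ 2)%N ->
  \sum_(z : F | z != 0) acorr wfull z ^+ 3 <= 10 ^+ 9 * (1 + harm R B ^+ 3).
Proof.
move=> qB; apply: le_trans (sum_acorrD3_le _ _) _.
have BR : 0 < B%:R :> R by rewrite ltr0n.
(* [2 * a + 2 * 16 * (a + 1 / B) = 34 * a + 32 / B], cubed by [cubeD_le]. The constant term sums to
   a bounded quantity because [q < 16 * B ^ 2]. *)
apply: (@le_trans _ _ (\sum_(z : F | z != 0) (4 * 34 ^+ 3 * acorr wshort z ^+ 3 + 4 * 32 ^+ 3 * (B%:R ^+ 3)^-1))).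
  apply: ler_sum => z z0.
  have h1 : 0 <= acorr wshort z by apply: acorr_ge0; exact: wshort_ge0.
  have h2 : 0 <= acorr wlong z by apply: acorr_ge0; exact: wlong_ge0.
  have h3 := acorr_wlong_le z0.
  rewrite ger0_norm; last by rewrite addr_ge0 ?mulr_ge0.
  have i0 : 0 <= B%:R^-1 :> R by rewrite invr_ge0 ltW.
  rewrite -exprVn; move: h1 h2 h3 i0.
  set a := acorr wshort z; set b := acorr wlong z; set v := B%:R^-1 => h1 h2 h3 v0.
  apply: (@le_trans _ _ ((34 * a + 32 * v) ^+ 3)).
    by rewrite lerXn2r ?nnegrE ?addr_ge0 ?mulr_ge0 //; lra.
  have -> : 4 * 34 ^+ 3 * a ^+ 3 + 4 * 32 ^+ 3 * v ^+ 3 = 4 * (34 * a) ^+ 3 + 4 * (32 * v) ^+ 3 by ring.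
  by apply: cubeD_le; rewrite mulr_ge0.
rewrite big_split /= -mulr_sumr.
have -> : \sum_(i : F | i != 0) 4 * 32 ^+ 3 * (B%:R ^+ 3)^-1 = 4 * 32 ^+ 3 * ((q.-1)%:R / B%:R ^+ 3) :> R.
  rewrite -(card_Fp_neq0 R q_pr) mulr_suml mulr_sumr; apply: eq_bigr => *; ring.
have h := sum_acorr_wshort3 R q_pr B_gt0 B_le.
have h2 : (q.-1)%:R / B%:R ^+ 3 <= 16 :> R.
  rewrite ler_pdivrMr ?exprn_gt0 // -[16]/(16%:R) -natrX -natrM ler_nat.
  apply: leq_trans (leq_pred _) (leq_trans (ltnW qB) _).
  by rewrite leq_mul2l leq_pexp2l ?orbT.
have H0 : 0 <= harm R B ^+ 3 by rewrite exprn_ge0 ?harm_ge0.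
move: h h2 H0; rewrite !exprS !expr0 !mulr1.
set S := \sum_(_ | _) _; set u := _ / _; set H := harm _ _ * _ => *; lra.
Qed.

End LongAutocorrelation.

(** * Summation by parts for [n^(-1/2)] and for its truncation near 0 *)

Section AbelSummation.
Variables (R : realType) (z : R[i]).
Hypothesis z1 : normc z = 1.
Local Notation rsq := (@rsq R).

Lemma abel_sum (v : nat -> R) m M : (m <= M)%N ->
  (1 - z) * \sum_(m <= n < M.+1) ((v n)%:C)%C * z ^+ n =
  ((v m)%:C)%C * z ^+ m + \sum_(m <= n < M) ((v n.+1 - v n)%:C)%C * z ^+ n.+1
   - ((v M)%:C)%C * z ^+ M.+1.
Proof.
move=> mM; rewrite -(subnKC mM); elim: (M - m)%N => [|k IH].
  by rewrite addn0 big_nat1 big_geq // exprS; ring.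
rewrite addnS big_nat_recr /=; last by rewrite -addnS leq_addr.
rewrite mulrDr IH [in RHS]big_nat_recr ?leq_addr //= rmorphB.
rewrite !exprS; ring.
Qed.

Lemma abel_le (v : nat -> R) m M : (m <= M)%N ->
  normc ((1 - z) * \sum_(m <= n < M.+1) ((v n)%:C)%C * z ^+ n) <=
  `|v m| + \sum_(m <= n < M) `|v n.+1 - v n| + `|v M|.
Proof.
have H (r : R) n : normc ((r%:C)%C * z ^+ n) = `|r|.
  by rewrite Normc.normcM normc_real normcX z1 expr1n mulr1.
move=> mM; rewrite abel_sum //.
apply: le_trans (le_normcD _ _) _; rewrite normcN H lerD2r.
apply: le_trans (le_normcD _ _) _; rewrite H lerD2l.
apply: le_trans (normc_sum _ _ _) _.
by apply: ler_sum => n _; rewrite H.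
Qed.

Lemma abel_rsq_le m M : (0 < m <= M)%N ->
  normc ((1 - z) * \sum_(m <= n < M.+1) ((rsq n)%:C)%C * z ^+ n) <= 2 * rsq m.
Proof.
move=> /andP[m0 mM]; apply: le_trans (abel_le _ mM) _.
have -> : \sum_(m <= n < M) `|rsq n.+1 - rsq n| = \sum_(m <= n < M) (- rsq n.+1 - - rsq n).
  apply: eq_big_nat => n /andP[mn _]; rewrite distrC ger0_norm ?subr_ge0.
    by rewrite opprK addrC.
  by apply: rsq_le => //; exact: leq_trans mn.
by rewrite telescope_sumr // !ger0_norm ?rsq_ge0 //; lra.
Qed.

Variable B : nat.
Hypothesis B_gt0 : (0 < B)%N.

Definition slope : R := (B%:R * Num.sqrt B%:R)^-1.

(** Below [B] the function [rsq] is replaced by the line from 0 to [rsq B]. Vanishing at 0 and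
    continuity at [B] are what make two summations by parts efficient. *)
Definition ramp (n : nat) : R := if (n < B)%N then n%:R * slope else rsq n.

Definition dramp n : R := ramp n.+1 - ramp n.

Let sB : 0 < Num.sqrt (B%:R : R). Proof. by rewrite sqrtr_gt0 ltr0n. Qed.
Let BR : 0 < B%:R :> R. Proof. by rewrite ltr0n. Qed.

Lemma slope_gt0 : 0 < slope.
Proof. by rewrite invr_gt0 mulr_gt0. Qed.

Lemma slopeB : B%:R * slope = rsq B.
Proof. by rewrite /slope /rsq; field; rewrite !lt0r_neq0. Qed.

Lemma ramp_ge n : (B <= n)%N -> ramp n = rsq n.
Proof. by move=> h; rewrite /ramp ltnNge h. Qed.

Lemma dramp_lt n : (n < B)%N -> dramp n = slope.
Proof.
move=> h; rewrite /dramp /ramp h; case: ltnP => h2.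
  by rewrite -natr1; ring.
have e : n.+1 = B by apply/eqP; rewrite eqn_leq h.
by rewrite e -slopeB -{1}e -natr1; ring.
Qed.

Lemma dramp_ge n : (B <= n)%N -> dramp n = rsq n.+1 - rsq n.
Proof. by move=> h; rewrite /dramp !ramp_ge // ltnW. Qed.

(** With [u = rsq n] and [v = rsq n.+1], the drop [u - v = u * v / (a + b)] is at most [u * u * v],
    because [u * a = 1]; and [slope = rsq B ^+ 3]. *)
Lemma dramp_bounds n : (B <= n)%N -> - slope <= dramp n <= 0.
Proof.
move=> h; have n0 : (0 < n)%N by exact: leq_trans h.
rewrite dramp_ge // subr_le0 rsq_le // andbT lerNl opprB.
have a2 := sqrtn_sqr R n; have b2 := sqrtn_sqr R n.+1; rewrite -natr1 in b2.
have ha := rsqE_sqrt R n0; have hb := @rsqE_sqrt R n.+1 isT; rewrite -natr1 in hb.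
have nR : 0 < n%:R :> R by rewrite ltr0n.
have a0 : 0 < Num.sqrt (n%:R : R) by rewrite sqrtr_gt0.
have b0 : 0 < Num.sqrt (n%:R + 1 : R) by rewrite sqrtr_gt0 addr_gt0.
have u0 := rsq_gt0 R n0; have v0 := @rsq_gt0 R n.+1 isT.
have uB : rsq n <= rsq B by apply: rsq_le.
have vu : rsq n.+1 <= rsq n by apply: rsq_le.
have sl : slope = rsq B * rsq B * rsq B.
  by rewrite -expr2 rsq_sqr /slope invfM.
move: a2 b2 ha hb a0 b0 u0 v0 uB vu; rewrite sl.
set a := Num.sqrt n%:R; set b := Num.sqrt _; set u := rsq n; set v := rsq n.+1; set w := rsq B.
move=> a2 b2 ha hb a0 b0 u0 v0 uB vu.
have e : (u - v) * (a + b) = u * v.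
  have -> : (u - v) * (a + b) = u * v * (b ^+ 2 - a ^+ 2) + (u * a) * (1 - v * b) * 1
     + u * b * (1 - v * b) - (v * b) * (1 - u * a) - v * a * (1 - u * a) by ring.
  by rewrite ha hb a2 b2; ring.
have d0 : 0 <= u - v by lra.
have c1 : u - v <= (u - v) * ((a + b) * u).
  rewrite -{1}[u - v]mulr1; apply: ler_wpM2l => //; rewrite mulrDl [a * u]mulrC ha.
  by rewrite lerDl mulr_ge0 ?ltW.
have c2 : (u - v) * ((a + b) * u) = u * v * u by rewrite mulrA e.
rewrite c2 in c1; apply: le_trans c1 _.
have vw : v <= w by exact: le_trans uB.
by apply: ler_pM => //; [rewrite mulr_ge0 // ltW | exact: ltW | apply: ler_pM => //; exact: ltW].
Qed.

(** Convexity of [n^(-1/2)]: from [n * (n + 2) <= (n + 1)^2] one gets [v ^+ 2 <= u * w], and the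
    arithmetic-geometric mean inequality concludes. *)
Lemma dramp_nd n : (B <= n)%N -> dramp n <= dramp n.+1.
Proof.
move=> h; have n0 : (0 < n)%N by exact: leq_trans h.
rewrite !dramp_ge ?leqW //.
have u0 := rsq_gt0 R n0; have v0 := @rsq_gt0 R n.+1 isT; have w0 := @rsq_gt0 R n.+2 isT.
have u2 := rsq_sqr R n; have v2 := rsq_sqr R n.+1; have w2 := rsq_sqr R n.+2.
move: u0 v0 w0 u2 v2 w2; set u := rsq n; set v := rsq n.+1; set w := rsq n.+2.
move=> u0 v0 w0 u2 v2 w2.
have h1 : v ^+ 2 <= u * w.
  have uw0 : 0 <= u * w by rewrite mulr_ge0 // ltW.
  rewrite -ler_sqr ?nnegrE ?sqr_ge0 ?uw0 //.
  rewrite [(u * w) ^+ 2]exprMn u2 w2 v2 -invfM exprVn lef_pV2 ?posrE ?exprn_gt0 ?mulr_gt0 ?ltr0n //.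
  by rewrite -natrX -natrM ler_nat -mulnn; lia.
suff : 2 * v <= u + w by lra.
have s1 : 0 <= 2 * v by lra.
have s2 : 0 <= u + w by lra.
rewrite -ler_sqr ?nnegrE //.
have := sqr_ge0 (u - w); rewrite [(2 * v) ^+ 2]exprMn; move: h1; rewrite !expr2; lra.
Qed.

(* [ramp] is piecewise linear-then-convex, so its second differences telescope. *)
Lemma sum_d2ramp_le M : (B <= M)%N ->
  \sum_(0 <= n < M) `|dramp n.+1 - dramp n| <= 3 * slope + dramp M.
Proof.
move=> h; rewrite -(subnKC h); elim: (M - B)%N => [|k IH].
  rewrite addn0 (@big_cat_nat _ _ _ B.-1) ?leq_pred //= big_nat_cond big1 ?add0r; last first.
    move=> i /andP[/andP[_ hi] _].
    by rewrite !dramp_lt ?subrr ?normr0 //; lia.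
  rewrite -{2}(prednK B_gt0) big_nat1 prednK // [dramp B.-1]dramp_lt ?prednK //.
  have /andP[d1 d2] := dramp_bounds (leqnn B); have := slope_gt0 => s0.
  by rewrite ler0_norm; lra.
rewrite addnS big_nat_recr //= ger0_norm; first by lra.
by rewrite subr_ge0 dramp_nd // leq_addr.
Qed.

(** The first summation by parts has no boundary term at 0 since [ramp 0 = 0]; the second is applied
    to [dramp], whose variation [sum_d2ramp_le] controls. The last term is the boundary term at the
    upper end. *)
Lemma ramp_sum_le M : (B <= M)%N ->
  normc ((1 - z) ^+ 2 * \sum_(1 <= n < M.+2) ((ramp n)%:C)%C * z ^+ n) <=
  5 * slope + 2 * rsq M.+1.
Proof.
move=> BM.
have r0 : ramp 0 = 0 by rewrite /ramp B_gt0 mul0r.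
have -> : \sum_(1 <= n < M.+2) ((ramp n)%:C)%C * z ^+ n =
    \sum_(0 <= n < M.+2) ((ramp n)%:C)%C * z ^+ n.
  by rewrite [RHS]big_ltn // r0 mul0r add0r.
rewrite exprS expr1 -mulrA abel_sum // r0 mul0r add0r mulrBr.
have nz : normc (1 - z) <= 2.
  by apply: le_trans (le_normcD _ _) _; rewrite normcN z1 Normc.normc1; lra.
apply: le_trans (le_normcD _ _) _; rewrite normcN; apply: lerD; last first.
  rewrite Normc.normcM [X in _ * X]Normc.normcM normcX z1 expr1n mulr1 normc_real ramp_ge ?leqW //.
  by rewrite ger0_norm ?rsq_ge0 // ler_wpM2r ?rsq_ge0.
have -> : \sum_(0 <= n < M.+1) ((ramp n.+1 - ramp n)%:C)%C * z ^+ n.+1 =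
    z * \sum_(0 <= n < M.+1) ((dramp n)%:C)%C * z ^+ n.
  by rewrite mulr_sumr; apply: eq_bigr => n _; rewrite exprS mulrCA.
rewrite mulrCA Normc.normcM z1 mul1r.
apply: le_trans (abel_le _ (leq0n M)) _.
have := sum_d2ramp_le BM; have /andP[d1 d2] := dramp_bounds BM.
rewrite (dramp_lt B_gt0) (gtr0_norm slope_gt0) (ler0_norm d2).
by have := slope_gt0; lra.
Qed.

End AbelSummation.

(** * The additive Fourier transform on ['F_q] *)

Section AdditiveFourier.
Variables (R : realType) (q : nat) (q_pr : prime q).
Local Notation C := (R[i]).
Local Notation F := 'F_q.
Local Notation rsq := (@rsq R).
Implicit Types (x y z a : F) (K : F -> R).

Let q0 : (0 < q)%N. Proof. exact: prime_gt0. Qed.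
Let qR : 0 < q%:R :> R. Proof. by rewrite ltr0n. Qed.

Definition addchi x : C := cis ((x : nat)%:R / q%:R).

Lemma addchi_nat n : addchi n%:R = cis (n%:R / q%:R).
Proof.
rewrite /addchi val_Fp_nat // {2}(divn_eq n q) natrD natrM mulrDl mulfK ?lt0r_neq0 //.
by rewrite cisD cis_int mul1r.
Qed.

Lemma addchiD x y : addchi (x + y) = addchi x * addchi y.
Proof.
by rewrite -[x]natr_Zp -[y]natr_Zp -natrD !addchi_nat -cisD -mulrDl -natrD.
Qed.

Lemma addchi0 : addchi 0 = 1.
Proof. by rewrite /addchi mul0r cis0. Qed.

Lemma normc_addchi x : normc (addchi x) = 1.
Proof. exact: normc_cis. Qed.

Lemma addchi_natM a n : addchi (a * n%:R) = addchi a ^+ n.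
Proof.
elim: n => [|n IH]; first by rewrite mulr0 addchi0 expr0.
by rewrite -natr1 mulrDr mulr1 addchiD IH exprSr.
Qed.

Lemma normc_1Baddchi_ge a : a != 0 -> 2 * ((absq a)%:R / q%:R) <= normc (1 - addchi a).
Proof.
move=> a0; have p : (0 < absq a)%N by rewrite absq_gt0.
have h : 2 * ((absq a)%:R / q%:R) <= normc (1 - addchi (absq a)%:R).
  rewrite addchi_nat; apply: normc_1Bcis_ge; first by rewrite divr_gt0 // ltr0n.
  rewrite ler_pdivrMr // -(ler_pM2l (_ : 0 < 2)) // mulrA divff // mul1r -natrM ler_nat.
  exact: absq_le_half.
case: (absqP q_pr a) => e; rewrite {2}e //; apply: le_trans h _.
set b := (absq a)%:R.
have -> : 1 - addchi b = - addchi b * (1 - addchi (- b)).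
  rewrite mulrBr mulr1 mulNr -addchiD subrr addchi0; ring.
by rewrite Normc.normcM normcN normc_addchi mul1r.
Qed.

Lemma sum_addchi a : \sum_x addchi (a * x) = if a == 0 then q%:R else 0.
Proof.
have [->|a0] := eqVneq a 0.
  by under eq_bigr do rewrite mul0r addchi0; rewrite sumr_const card_Fp.
have h : addchi a != 1.
  apply/eqP => e; have := normc_1Baddchi_ge a0.
  rewrite e subrr Normc.normc0; apply/negP; rewrite -ltNge.
  by rewrite mulr_gt0 // divr_gt0 // ltr0n absq_gt0.
have e : addchi a * (\sum_x addchi (a * x)) = \sum_x addchi (a * x).
  rewrite mulr_sumr [RHS](reindex_inj (addrI 1)) /=.
  by apply: eq_bigr => x _; rewrite -addchiD mulrDr mulr1.
apply/eqP; move/eqP: e; rewrite -subr_eq0 -{2}[\sum_x _]mul1r -mulrBl mulf_eq0.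
by rewrite subr_eq0 (negPf h).
Qed.

Definition addhat K a : C := \sum_x ((K x)%:C)%C * addchi (a * x).

Lemma addhat_inv K y : q%:R * ((K y)%:C)%C = \sum_a addhat K a * addchi (- (a * y)).
Proof.
rewrite /addhat; under eq_bigr do rewrite mulr_suml.
rewrite exchange_big /= (bigD1 y) //= [X in _ + X]big1 ?addr0.
  under eq_bigr do rewrite -mulrA -addchiD subrr addchi0 mulr1.
  by rewrite sumr_const card_Fp // mulr_natl.
move=> x xy.
under eq_bigr do rewrite -mulrA -addchiD -mulrBr mulrC.
rewrite -mulr_suml.
have -> : \sum_a addchi (a * (x - y)) = \sum_a addchi ((x - y) * a).
  by apply: eq_bigr => a _; rewrite mulrC.
by rewrite sum_addchi subr_eq0 (negPf xy) mul0r.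
Qed.

Lemma additive_parseval K z :
  q%:R * ((\sum_y K (z * y) * K y)%:C)%C = \sum_a addhat K a * addhat K (- (a * z)).
Proof.
rewrite rmorph_sum mulr_sumr.
under eq_bigr do rewrite rmorphM mulrA addhat_inv mulr_suml.
rewrite exchange_big /=; apply: eq_bigr => a _.
rewrite [X in _ * X]/addhat mulr_sumr; apply: eq_bigr => y _.
by rewrite mulrA mulNr -!mulrA; congr (_ * _); rewrite mulrC.
Qed.

(** Parseval pairs the frequencies [a] and [- (a * z)]. As [w] is even, the two bounds multiply to
    [c ^+ 2 * q * w a * w (z * a)], which sums to an autocorrelation of [w]. *)
Lemma corr_le K (w : F -> R) (c : R) z : z != 0 -> 0 <= c ->
  (forall x, 0 <= w x) -> (forall x, w (- x) = w x) -> addhat K 0 = 0 ->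
  (forall a, a != 0 -> normc (addhat K a) <= c * Num.sqrt q%:R * w a) ->
  `|\sum_y K (z * y) * K y| <= c ^+ 2 * acorr w z.
Proof.
move=> z0 c0 w0 wN K0 hK.
rewrite -(ler_pM2l qR) -{1}(gtr0_norm qR) -normrM -normc_real rmorphM rmorph_nat.
rewrite additive_parseval (bigD1 0) //= K0 mul0r add0r.
apply: le_trans (normc_sum _ _ _) _.
rewrite /acorr !mulr_sumr; apply: ler_sum => a a0.
rewrite Normc.normcM.
have b0 : - (a * z) != 0 by rewrite oppr_eq0 mulf_neq0.
apply: le_trans (ler_pM (normc_ge0 _) (normc_ge0 _) (hK a a0) (hK _ b0)) _.
rewrite wN [a * z]mulrC; have := @sqrtn_sqr R q; set r := Num.sqrt _ => <-.
by rewrite le_eqVlt; apply/orP; left; apply/eqP; ring.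
Qed.

Variable B : nat.
Hypothesis B_gt0 : (0 < B)%N.
Hypothesis B_le : (4 * B ^ 2 <= q)%N.
Hypothesis B_gt : (q < 16 * B ^ 2)%N.
Local Notation kern := (@kern R q).
Local Notation ramp := (@ramp R B).
Local Notation wfull := (@wfull R q B).

Definition small n : R := if (n < B)%N then rsq n - n%:R * slope R B else 0.

Lemma rampE n : ramp n = rsq n - small n.
Proof. by rewrite /ramp /small; case: ifP => _; [ring | rewrite subr0]. Qed.

Lemma small_bounds n : (0 < n)%N -> 0 <= small n <= rsq n.
Proof.
move=> n0; have s0 := slope_gt0 R B_gt0.
rewrite /small; case: ifP => h; last by rewrite lexx rsq_ge0.
have p0 : 0 <= n%:R * slope R B by rewrite mulr_ge0 // ltW.
rewrite gerBl p0 andbT subr_ge0.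
apply: (@le_trans _ _ (B%:R * slope R B)); first by rewrite ler_wpM2r ?(ltW s0) // ler_nat ltnW.
by rewrite slopeB //; apply: rsq_le => //; exact: ltnW.
Qed.

Let BR : 0 < B%:R :> R. Proof. by rewrite ltr0n. Qed.
Let s := Num.sqrt (q%:R : R).
Let s_gt0 : 0 < s. Proof. by rewrite sqrtr_gt0. Qed.
Let s2 : s ^+ 2 = q%:R. Proof. by rewrite sqr_sqrtr. Qed.

(** For [absq a >= B], two summations by parts. For [absq a < B], the sum is cut near [q / absq a]:
    the head is bounded trivially, the tail by one summation by parts. The last term disappears as
    [N] grows. *)
Lemma ramp_psum_le a N : a != 0 -> (B < N)%N ->
  normc (\sum_(1 <= n < N.+1) ((ramp n)%:C)%C * addchi a ^+ n) <=
  80 * s * wfull a + 2 * rsq N * (q%:R / (2 * (absq a)%:R)) ^+ 2.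
Proof.
move=> a0 BN; have al0 : (0 < absq a)%N by rewrite absq_gt0.
have aR : 0 < (absq a)%:R :> R by rewrite ltr0n.
have z1 := normc_addchi a; set z := addchi a in z1 *.
have hz : 2 * ((absq a)%:R / q%:R) <= normc (1 - z) by exact: normc_1Baddchi_ge.
have nz0 : 0 < normc (1 - z) by apply: lt_le_trans hz; rewrite mulr_gt0 // divr_gt0.
set D := q%:R / (2 * (absq a)%:R).
have D0 : 0 < D by rewrite divr_gt0 // mulr_gt0.
have Dz : 1 <= D * normc (1 - z).
  apply: le_trans (_ : D * (2 * ((absq a)%:R / q%:R)) <= _); last by rewrite ler_pM2l.
  rewrite le_eqVlt; apply/orP; left; apply/eqP; rewrite /D; field.
  by rewrite !lt0r_neq0.
have sc (w : C) (e : R) : 0 <= e -> normc ((1 - z) * w) <= e -> normc w <= D * e.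
  move=> e0; rewrite Normc.normcM => h.
  apply: le_trans (_ : (D * normc (1 - z)) * normc w <= _).
    by rewrite -{1}[normc w]mul1r ler_wpM2r ?normc_ge0.
  by rewrite -mulrA ler_pM2l.
have t0 : 0 <= 2 * rsq N * D ^+ 2 by rewrite !mulr_ge0 ?rsq_ge0 // ltW.
rewrite /wfull /wshort /wlong; case: ltnP => hB; last first.
  rewrite add0r; case: N BN t0 => // M BM t0.
  have h1 := ramp_sum_le z1 B_gt0 BM; rewrite expr2 -mulrA in h1.
  have e0 : 0 <= 5 * slope R B + 2 * rsq M.+1.
    by rewrite addr_ge0 ?mulr_ge0 ?rsq_ge0 // ltW // slope_gt0.
  have h2 := sc _ _ e0 h1.
  have h3 := sc _ _ (mulr_ge0 (ltW D0) e0) h2.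
  apply: le_trans h3 _.
  have -> : D * (D * (5 * slope R B + 2 * rsq M.+1)) = 5 * slope R B * D ^+ 2 + 2 * rsq M.+1 * D ^+ 2 by ring.
  rewrite lerD2r.
  have sB : 0 < Num.sqrt (B%:R : R) by rewrite sqrtr_gt0.
  have s4 : s <= 4 * B%:R.
    rewrite -ler_sqr ?nnegrE ?(ltW s_gt0) ?mulr_ge0 // s2.
    have -> : (4 * B%:R) ^+ 2 = (16 * B ^ 2)%N%:R :> R by rewrite natrM natrX; ring.
    by rewrite ler_nat ltnW.
  (* The constant 80 is [(5 / 4) * 64], where [5 / 4] comes from [5 * slope * D ^+ 2]. *)
  have s3 : s ^+ 3 <= 64 * B%:R ^+ 3.
    have -> : 64 * B%:R ^+ 3 = (4 * B%:R) ^+ 3 :> R by ring.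
    by rewrite lerXn2r ?nnegrE ?(ltW s_gt0) // mulr_ge0.
  have -> : 5 * slope R B * D ^+ 2 = (s * (5 * s ^+ 3 / 4)) / (B%:R * Num.sqrt B%:R * (absq a)%:R ^+ 2).
    rewrite /D -s2 /slope; field; by rewrite !lt0r_neq0.
  have -> : 80 * s * (B%:R * Num.sqrt B%:R / (absq a)%:R ^+ 2) =
     (s * (80 * B%:R ^+ 2 * (Num.sqrt B%:R ^+ 2))) / (B%:R * Num.sqrt B%:R * (absq a)%:R ^+ 2).
    by field; rewrite !lt0r_neq0.
  rewrite sqrtn_sqr; apply: ler_wpM2r.
    by rewrite invr_ge0; apply: ltW; rewrite !mulr_gt0 // exprn_gt0.
  rewrite ler_pM2l //; have -> : 80 * B%:R ^+ 2 * B%:R = 80 * B%:R ^+ 3 :> R by ring.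
  lra.
rewrite addr0; set al := absq a in al0 aR hB D D0 Dz sc t0 *.
(* At this cut both parts have size [s * rsq al]; moreover [B <= Y], so [ramp] is just [rsq] on the
   tail. *)
pose Y := (q %/ al)%N.
have YB : (B <= Y)%N.
  rewrite leq_divRL //; apply: leq_trans B_le; rewrite -mulnn mulnCA leq_mul2l.
  by apply/orP; right; lia.
have Y0 : (0 < Y)%N by exact: leq_trans YB.
have Y1 : (Y * al <= q)%N by exact: leq_trunc_div.
have Y2 : (q <= 2 * (Y * al))%N by have := ltn_ceil q al0; rewrite -/Y mulSn; nia.
have YR : 0 < Y%:R :> R by rewrite ltr0n.
have r0 : 0 < rsq al by apply: rsq_gt0.
have head M : (M <= Y)%N -> normc (\sum_(1 <= n < M.+1) ((ramp n)%:C)%C * z ^+ n) <= 2 * (s * rsq al).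
  move=> MY; apply: le_trans (normc_sum _ _ _) _.
  apply: (@le_trans _ _ (\sum_(1 <= n < M.+1) rsq n)).
    apply: ler_sum_nat => n /andP[n0 _].
    rewrite Normc.normcM normcX z1 expr1n mulr1 normc_real.
    have /andP[p1 p2] := small_bounds n0.
    by rewrite rampE ger0_norm; lra.
  apply: le_trans (sum_rsq_le R M) _; rewrite ler_pM2l //.
  rewrite -ler_sqr ?nnegrE ?sqrtr_ge0 ?mulr_ge0 ?(ltW s_gt0) ?rsq_ge0 //.
  rewrite sqrtn_sqr exprMn s2 rsq_sqr ler_pdivlMr // -natrM ler_nat.
  by apply: leq_trans Y1; rewrite leq_mul2r MY orbT.
have [NY|YN] := leqP N Y.
  apply: le_trans (head N NY) _; rewrite -[leLHS]addr0 lerD //.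
  by have : 0 <= s * rsq al by [rewrite mulr_ge0 ?ltW]; lra.
rewrite (@big_cat_nat _ _ _ Y) //=; last exact: leqW (ltnW YN).
have h1 : normc (\sum_(1 <= n < Y) ((ramp n)%:C)%C * z ^+ n) <= 2 * (s * rsq al).
  by rewrite -(prednK Y0); apply: head; exact: leq_pred.
have h2 : normc (\sum_(Y <= n < N.+1) ((ramp n)%:C)%C * z ^+ n) <= D * (2 * rsq Y).
  apply: sc; first by rewrite mulr_ge0 ?rsq_ge0.
  have -> : \sum_(Y <= n < N.+1) ((ramp n)%:C)%C * z ^+ n = \sum_(Y <= n < N.+1) ((rsq n)%:C)%C * z ^+ n.
    by apply: eq_big_nat => n /andP[Yn _]; rewrite ramp_ge // (leq_trans YB).
  by apply: abel_rsq_le => //; rewrite Y0 ltnW.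
have h3 : D * (2 * rsq Y) <= 2 * (s * rsq al).
  rewrite -ler_sqr ?nnegrE ?mulr_ge0 ?(ltW s_gt0) ?(ltW D0) ?rsq_ge0 //.
  have -> : (D * (2 * rsq Y)) ^+ 2 = D ^+ 2 * 4 * rsq Y ^+ 2 by ring.
  have -> : (2 * (s * rsq al)) ^+ 2 = 4 * s ^+ 2 * rsq al ^+ 2 by ring.
  rewrite !rsq_sqr s2 /D.
  have -> : (q%:R / (2 * al%:R)) ^+ 2 * 4 / Y%:R = q%:R / (al%:R * al%:R * Y%:R) * q%:R :> R.
    by field; rewrite !lt0r_neq0.
  have -> : 4 * q%:R / al%:R = q%:R / (al%:R * al%:R * Y%:R) * (4 * (Y%:R * al%:R)) :> R.
    by field; rewrite !lt0r_neq0.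
  apply: ler_wpM2l; first by rewrite divr_ge0 // !mulr_ge0 // ltW.
  rewrite -natrM.
  have : q%:R <= 2 * (Y * al)%N%:R :> R by rewrite -natrM ler_nat.
  have : 0 <= (Y * al)%N%:R :> R by [].
  lra.
apply: le_trans (le_normcD _ _) _.
have : 0 <= s * rsq al by rewrite mulr_ge0 ?ltW.
rewrite -mulrA; lra.
Qed.

End AdditiveFourier.

(** * The second moment over triples of characters with a given product *)

Lemma exists_quarter_sqrt q : (4 <= q)%N ->
  exists B, [/\ (0 < B)%N, (4 * B ^ 2 <= q)%N & (q < 16 * B ^ 2)%N].
Proof.
move=> q4; have ex : exists i, (4 * i ^ 2 <= q)%N by exists 1%N.
have ub i : (4 * i ^ 2 <= q)%N -> (i <= q)%N.
  by move=> h; apply: leq_trans h; rewrite -mulnn mulnA; case: i => // i; rewrite leq_pmull.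
case: (ex_maxnP ex ub) => B hB max; exists B.
have B0 : (0 < B)%N by apply: (max 1%N).
split => //; rewrite ltnNge; apply/negP => h.
have h2 : (4 * B.+1 ^ 2 <= q)%N by apply: leq_trans h; rewrite -!mulnn; nia.
by have := max _ h2; rewrite ltnn.
Qed.

Lemma quarter_sqrt_lt B q : (0 < B)%N -> (4 * B ^ 2 <= q)%N -> (B < q)%N.
Proof. by rewrite -mulnn; nia. Qed.

Section TripleSecondMoment.
Variables (R : realType) (q : nat) (q_pr : prime q).
Local Notation C := (R[i]).
Local Notation F := 'F_q.
Local Notation I := 'I_(q.-2.+1).
Local Notation rsq := (@rsq R).
Local Notation kern := (@kern R q).
Variable B : nat.
Hypothesis B_gt0 : (0 < B)%N.
Hypothesis B_le : (4 * B ^ 2 <= q)%N.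
Hypothesis B_gt : (q < 16 * B ^ 2)%N.
Local Notation small := (@small R B).
Local Notation wfull := (@wfull R q B).

Let q0 : (0 < q)%N. Proof. exact: prime_gt0. Qed.
Let qR : 0 < q%:R :> R. Proof. by rewrite ltr0n. Qed.
Let s := Num.sqrt (q%:R : R).
Let s_gt0 : 0 < s. Proof. by rewrite sqrtr_gt0. Qed.
Let s2 : s ^+ 2 = q%:R. Proof. by rewrite sqr_sqrtr. Qed.

(** The class of 0 is represented by [q], where [kern] and [small] both vanish; this dictates the
    value at 0. *)
Definition kdiff (x : F) : R := if x == 0 then 0 else kern x - small x.
Definition kmean : R := (\sum_x kdiff x) / q%:R.
(* Centered over all of Z/q, so that its additive transform vanishes at 0. *)
Definition klong (x : F) : R := kdiff x - kmean.

Lemma kern_q : kern q = 0.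
Proof.
have e : pkern R q q = fun=> 0.
  by apply/funext => k; rewrite /pkern big1 // => j _; rewrite subrr.
by rewrite /kern e; exact: lim_cst.
Qed.

Lemma addhat_klong0 : addhat klong 0 = 0.
Proof.
rewrite /addhat; under eq_bigr do rewrite mul0r addchi0 mulr1.
rewrite -rmorph_sum /klong sumrB sumr_const card_Fp // -mulr_natr /kmean.
by rewrite mulfVK ?subrr // lt0r_neq0.
Qed.

Lemma addhat_klong a : a != 0 ->
  addhat klong a = \sum_(1 <= n < q.+1) addchi R a ^+ n * ((kern n - small n)%:C)%C.
Proof.
move=> a0; rewrite /addhat.
have -> : \sum_x ((klong x)%:C)%C * addchi R (a * x) =
    \sum_x ((kdiff x)%:C)%C * addchi R (a * x) - (kmean%:C)%C * \sum_x addchi R (a * x).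
  by rewrite mulr_sumr -sumrB; apply: eq_bigr => x _; rewrite rmorphB mulrBl.
rewrite sum_addchi // (negPf a0) mulr0 subr0 (bigD1 0) //= {1}/kdiff eqxx mul0r add0r.
rewrite big_nat_recr //= kern_q /small ltnNge (ltnW (quarter_sqrt_lt B_gt0 B_le)) /=.
rewrite subr0 mulr0 addr0 -(@sum_Fp_neq0 q q_pr _ (fun n => addchi R a ^+ n * ((kern n - small n)%:C)%C)).
apply: eq_bigr => x x0; rewrite /kdiff (negPf x0) mulrC; congr (_ * _).
by rewrite -addchi_natM // natr_Zp.
Qed.

(** [twisted_psum_cvg] with an additive character as coefficients yields the transform of [kern].
    Subtracting the finite sum of [small] turns [rsq] into [ramp] on one side and [kern] into
    [kdiff] on the other. *)
Lemma ramp_psum_cvg a : a != 0 ->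
  ccvg (fun N => \sum_(1 <= n < N.+1) ((ramp R B n)%:C)%C * addchi R a ^+ n) (addhat klong a).
Proof.
move=> a0 e e0.
have g1 n : normc (addchi R a ^+ n) <= 1 by rewrite normcX normc_addchi expr1n.
have gp n : addchi R a ^+ (n + q) = addchi R a ^+ n.
  by rewrite -!addchi_natM // natrD pchar_Fp_0 // addr0.
have gs : \sum_(1 <= x < q.+1) addchi R a ^+ x = 0.
  rewrite big_nat_recr //= -[in X in _ + X]addchi_natM // pchar_Fp_0 // mulr0 addchi0.
  have := sum_addchi R q_pr a; rewrite (negPf a0) (bigD1 0) //= mulr0 addchi0 addrC => h.
  rewrite -[RHS]h -(@sum_Fp_neq0 q q_pr _ (fun n => addchi R a ^+ n)); congr (_ + _).
  by apply: eq_bigr => x _; rewrite -addchi_natM // natr_Zp.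
have [N0 hN] := twisted_psum_cvg q0 g1 gp gs e0.
exists (maxn N0 B) => n; rewrite geq_max => /andP[n1 n2].
rewrite addhat_klong //.
have cut M : (B <= M)%N -> \sum_(1 <= n < M.+1) addchi R a ^+ n * ((small n)%:C)%C =
    \sum_(1 <= n < B) addchi R a ^+ n * ((small n)%:C)%C.
  move=> BM; rewrite (@big_cat_nat _ _ _ B) //= ?leqW //.
  rewrite [X in _ + X]big_nat_cond [X in _ + X]big1 ?addr0 // => i /andP[/andP[Bi _] _].
  by rewrite /small ltnNge Bi mulr0.
have e1 : \sum_(1 <= x < q.+1) addchi R a ^+ x * ((kern x - small x)%:C)%C =
    \sum_(1 <= x < q.+1) addchi R a ^+ x * ((kern x)%:C)%C - \sum_(1 <= n < B) addchi R a ^+ n * ((small n)%:C)%C.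
  rewrite -(cut q); last exact: ltnW (quarter_sqrt_lt B_gt0 B_le).
  by rewrite -sumrB; apply: eq_bigr => x _; rewrite rmorphB mulrBr.
have e2 : \sum_(1 <= i < n.+1) ((ramp R B i)%:C)%C * addchi R a ^+ i =
    \sum_(1 <= x < n.+1) addchi R a ^+ x * ((rsq x)%:C)%C - \sum_(1 <= n < B) addchi R a ^+ n * ((small n)%:C)%C.
  rewrite -(cut n) // -sumrB; apply: eq_bigr => x _.
  by rewrite rampE rmorphB mulrC mulrBr.
rewrite e1 e2 opprB addrA subrK; exact: hN.
Qed.

Lemma addhat_klong_le a : a != 0 -> normc (addhat klong a) <= 80 * s * wfull a.
Proof.
move=> a0; apply: (ccvg_normc_le (ramp_psum_cvg a0)) => e e0.
set D := (q%:R / (2 * (absq a)%:R)) ^+ 2 : R.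
have D0 : 0 <= D by exact: sqr_ge0.
(* Beyond [M] the boundary term [2 * rsq n * D] of [ramp_psum_le] is at most [e]. *)
pose M := Num.bound ((2 * D / e) ^+ 2).
exists (maxn M.+1 B.+1) => n; rewrite geq_max => /andP[n1 n2].
apply: le_trans (ramp_psum_le R q_pr B_gt0 B_le B_gt a0 n2) _.
rewrite lerD2l -/D.
have nR : 0 < n%:R :> R by rewrite ltr0n; exact: leq_trans n1.
have h : 2 * D / e <= Num.sqrt n%:R.
  rewrite -ler_sqr ?nnegrE ?sqrtr_ge0 ?divr_ge0 ?mulr_ge0 ?(ltW e0) // sqrtn_sqr.
  apply: le_trans (ltW (archi_boundP (sqr_ge0 _))) _.
  by rewrite ler_nat; exact: ltnW.
have sn : 0 < Num.sqrt (n%:R : R) by rewrite sqrtr_gt0.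
move: h; rewrite ler_pdivrMr // => h.
rewrite /rsq mulrAC ler_pdivrMr // mulrC [leRHS]mulrC; lra.
Qed.

Lemma kmean_sqr_le : kmean ^+ 2 <= 4 / q%:R.
Proof.
have h : `|\sum_x kdiff x| <= 2 * s.
  apply: le_trans (ler_norm_sum _ _ _) _.
  rewrite (bigD1 0) //= /kdiff eqxx normr0 add0r.
  apply: le_trans (sum_Fp_rsq_le R q_pr); apply: ler_sum => x x0.
  rewrite (negPf x0); have /andP[h1 h2] := kern_Fp_bounds R q_pr x0.
  have /andP[x1 xq] := val_Fp_bounds q_pr x0.
  have /andP[h3 h4] := small_bounds R B_gt0 x1.
  have h5 : rsq q <= rsq x by apply: rsq_le => //; exact: ltnW.
  by rewrite ler_norml; apply/andP; split; lra.
rewrite /kmean exprMn -real_normK ?num_real //.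
have : `|\sum_x kdiff x| ^+ 2 <= (2 * s) ^+ 2 by rewrite lerXn2r ?nnegrE // mulr_ge0 // ltW.
rewrite [(2 * s) ^+ 2]exprMn s2 => h2.
apply: le_trans (ler_wpM2r _ h2) _; first exact: sqr_ge0.
rewrite le_eqVlt; apply/orP; left; apply/eqP; field; exact: lt0r_neq0.
Qed.

Lemma wshort_le_wfull x : wshort R B x <= wfull x.
Proof. by rewrite lerDl wlong_ge0. Qed.

Lemma wfull_ge0 x : 0 <= wfull x.
Proof. by rewrite addr_ge0 ?wshort_ge0 ?wlong_ge0. Qed.

(** [corr_le] with constant 80 treats the correlation over all of ['F_q]; [acorr] omits [y = 0],
    whose term is [kmean ^+ 2]. *)
Lemma acorr_klong_le z : z != 0 -> `|acorr klong z| <= 6400 * acorr wfull z + 4 / q%:R.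
Proof.
move=> z0.
have -> : acorr klong z = \sum_y klong (z * y) * klong y - kmean ^+ 2.
  rewrite (bigD1 0) //= mulr0 /klong /kdiff eqxx sub0r mulrNN -expr2 addrAC subrr add0r //.
apply: le_trans (ler_normB _ _) _; apply: lerD; last first.
  by rewrite ger0_norm ?sqr_ge0 // kmean_sqr_le.
have -> : 6400 = 80 ^+ 2 :> R by ring.
apply: corr_le => //; first exact: wfull_ge0.
- by move=> x; rewrite /wfull /wshort /wlong absqN.
- exact: addhat_klong0.
exact: addhat_klong_le.
Qed.

Lemma acorr_small_le z : z != 0 -> `|acorr (fun x : F => small x) z| <= acorr wfull z.
Proof.
move=> z0.
have hs (x : F) : x != 0 -> 0 <= small x <= wfull x.
  move=> x0; have /andP[x1 xq] := val_Fp_bounds q_pr x0.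
  have /andP[h3 h4] := small_bounds R B_gt0 x1; rewrite h3 /=.
  rewrite /small; case: ifP => hB; last exact: wfull_ge0.
  apply: le_trans (wshort_le_wfull x); apply: le_trans (_ : rsq x <= _).
    by move: h4; rewrite /small hB.
  have ax : absq x = x :> nat.
    by apply/minn_idPl; move: B_le; rewrite -mulnn; nia.
  by rewrite /wshort ax hB.
have s0 (x : F) : x != 0 -> 0 <= small x by move=> /hs/andP[].
rewrite ger0_norm; last first.
  by apply: sumr_ge0 => y y0; rewrite mulr_ge0 // s0 // mulf_neq0.
apply: ler_sum => y y0; have /andP[a1 a2] := hs y y0.
have /andP[b1 b2] := hs (z * y) (mulf_neq0 z0 y0).
exact: ler_pM.
Qed.

(** On the units [kern] is [small] plus [klong] plus a constant that nontrivial characters do not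
    see. Majorizing [|L|^2] spectrally and applying [conv3_le] reduces the bound to the cubes of
    [acorr wfull]. *)
Lemma triple_second_moment t :
  \sum_(i : I) \sum_j normc (Lchi0 R i) ^+ 2 * normc (Lchi0 R j) ^+ 2 * normc (Lchi0 R (t - i - j)) ^+ 2
  <= (q.-1)%:R ^+ 2 * (10 ^+ 22 * (1 + harm R B ^+ 3)).
Proof.
pose p (x : F) : R := small x.
pose A (j : I) : R := normc (Lchi0 R j) ^+ 2.
pose U (j : I) : R := 2 * normc (hat p j) ^+ 2 + 2 * normc (hat klong j) ^+ 2.
have AU j : 0 <= A j <= U j.
  rewrite sqr_ge0 /A /U /Lchi0 /=; case: eqP => [_|/eqP j0].
    by rewrite Normc.normc0 expr0n /= addr_ge0 // mulr_ge0 // sqr_ge0.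
  have -> : Lchi R j = hat p j + hat klong j.
    rewrite -hatD /Lchi.
    transitivity (hat (fun x => (p x + klong x) + kmean) j); last by rewrite hatD hat_cst // addr0.
    by apply: eq_hat => x x0; rewrite /klong /kdiff (negPf x0) /p; ring.
  exact: normcD_sqr_le.
have hU j : hat (fun z => 2 * acorr p z + 2 * acorr klong z) j = ((U j)%:C)%C.
  by rewrite hatD !hatZ !hat_acorr // -!rmorphM -rmorphD.
apply: le_trans (conv3_le q_pr t AU hU) _; rewrite ler_wpM2l ?sqr_ge0 //.
(* The constant is kept abstract: unification must not unfold the numeral. *)
have [c [c0 cE]] : exists c : R, 0 <= c /\ c = 2 * 6401.
  by exists (2 * 6401); split; [lra | reflexivity].
(* Twice the bound 1 for [small] plus twice 6400 for [klong] gives [c = 2 * 6401], and [8 / q] is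
   twice [4 / q]. *)
apply: (@le_trans _ _ (\sum_(z : F | z != 0) (4 * c ^+ 3 * acorr wfull z ^+ 3 + 4 * (8 / q%:R) ^+ 3))).
  apply: ler_sum => z z0.
  have h1 := acorr_small_le z0; have h2 := acorr_klong_le z0.
  have g0 : 0 <= acorr wfull z by apply: acorr_ge0; exact: wfull_ge0.
  have v0 : 0 <= 8 / q%:R :> R by rewrite divr_ge0.
  have h3 : `|2 * acorr p z + 2 * acorr klong z| <= c * acorr wfull z + 8 / q%:R.
    apply: le_trans (ler_normD _ _) _; rewrite !normrM ger0_norm //; move: h1; rewrite -/p.
    have -> : 8 / q%:R = 2 * (4 / q%:R) :> R by field; exact: lt0r_neq0.
    by rewrite cE; lra.
  have p0 : 0 <= c * acorr wfull z + 8 / q%:R by exact: le_trans (normr_ge0 _) h3.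
  apply: le_trans (_ : (c * acorr wfull z + 8 / q%:R) ^+ 3 <= _).
    by rewrite lerXn2r ?nnegrE.
  apply: le_trans (cubeD_le (mulr_ge0 c0 g0) v0) _.
  by rewrite [(c * _) ^+ 3]exprMn mulrA.
rewrite big_split /= -mulr_sumr.
have -> : \sum_(i : F | i != 0) 4 * (8 / q%:R) ^+ 3 = 4 * (8 / q%:R) ^+ 3 * (q.-1)%:R :> R.
  by rewrite -(card_Fp_neq0 R q_pr) mulr_sumr; apply: eq_bigr => *; rewrite mulr1.
have h := sum_acorr_wfull3 R q_pr B_gt0 B_le B_gt.
have H0 : 0 <= harm R B ^+ 3 by rewrite exprn_ge0 ?harm_ge0.
have q1 : 1 <= q%:R :> R by rewrite ler1n.
have c1 : (8 / q%:R) ^+ 3 * (q.-1)%:R <= 512 :> R.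
  apply: (@le_trans _ _ (8 ^+ 3 * ((q%:R ^+ 2)^-1))).
    have -> : 8 ^+ 3 * (q%:R ^+ 2)^-1 = (8 / q%:R) ^+ 3 * q%:R :> R by field; exact: lt0r_neq0.
    apply: ler_wpM2l; first by rewrite exprn_ge0 // divr_ge0.
    by rewrite ler_nat leq_pred.
  have : (q%:R ^+ 2)^-1 <= 1 :> R by rewrite invf_le1 ?exprn_gt0 // exprn_ege1.
  by rewrite !exprS expr0; lra.
rewrite -[4 * (_ ^+ 3) * (q.-1)%:R]mulrA cE.
move: h c1 H0; rewrite !exprS !expr0 !mulr1.
set S := \sum_(_ | _) _; set u := _ * (q.-1)%:R; set H := harm _ _ * _ => *.
lra.
Qed.

End TripleSecondMoment.

(** * Counting the tuples *)

Section Counting.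
Variables (R : realType) (q : nat) (q_pr : prime q).
Local Notation C := (R[i]).
Local Notation I := 'I_(q.-2.+1).
Local Notation nonvan := (@nonvan R q).
Let q0 : (0 < q)%N. Proof. exact: prime_gt0. Qed.
Let qR : 0 < q%:R :> R. Proof. by rewrite ltr0n. Qed.
Let s := Num.sqrt (q%:R : R).
Let s_gt0 : 0 < s. Proof. by rewrite sqrtr_gt0. Qed.
Let s2 : s ^+ 2 = q%:R. Proof. by rewrite sqr_sqrtr. Qed.

Definition triples (t : I) : {set I * I} :=
  [set p | [&& p.1 \in nonvan, p.2 \in nonvan & t - p.1 - p.2 \in nonvan]].

Lemma Lchi0_eq0 j : j \notin nonvan -> Lchi0 R j = 0.
Proof.
rewrite inE negb_and !negbK /Lchi0; case: eqP => //= _ /eqP //.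
Qed.

Lemma one_le_ln : 10 ^+ 4 <= Num.sqrt s -> 1 <= ln (q%:R : R).
Proof.
set y := Num.sqrt s => y1.
have y10 : 10 <= y by apply: le_trans y1; rewrite !exprS expr0; lra.
have y2 : y ^+ 2 = s by rewrite sqr_sqrtr // ltW.
have h4 : 4 <= q%:R :> R by rewrite -s2 -y2; have : 100 <= y ^+ 2; [rewrite expr2; nra | rewrite [(y ^+ 2) ^+ 2]expr2; nra].
exact: ln_ge1.
Qed.

(** Cauchy-Schwarz over the nonvanishing triples. With [N = q - 1 >= q / 2] the count is at least
    [N ^+ 2 / (400 * 9 * 10^22 * l^3)], and [4 * 400 * 9 * 10^22 <= 10^27]. *)
Lemma triples_card_ge t : 10 ^+ 4 <= Num.sqrt s ->
  (10 ^+ 27)^-1 * q%:R ^+ 2 / ln q%:R ^+ 3 <= #|triples t|%:R :> R.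
Proof.
move=> y1; have l1 := one_le_ln y1; set l := ln _ in l1 *.
have q4 : (4 <= q)%N.
  rewrite -(ler_nat R).
  have y10 : 10 <= Num.sqrt s by apply: le_trans y1; rewrite !exprS expr0; lra.
  have y2 : Num.sqrt s ^+ 2 = s by rewrite sqr_sqrtr // ltW.
  have s10 : 100 <= s by rewrite -y2 expr2; nra.
  by rewrite -s2 expr2; nra.
have [B [B0 B1 B2]] := exists_quarter_sqrt q4.
pose a (p : I * I) : R := normc (Lchi0 R p.1) * normc (Lchi0 R p.2) * normc (Lchi0 R (t - p.1 - p.2)).
have T1 : normc (\sum_i \sum_j Lchi0 R i * Lchi0 R j * Lchi0 R (t - i - j)) <= \sum_(p in triples t) a p.
  rewrite pair_bigA /=; apply: le_trans (normc_sum _ _ _) _.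
  rewrite (bigID (fun p => p \in triples t)) /= [X in _ + X]big1 ?addr0.
    by rewrite le_eqVlt; apply/orP; left; apply/eqP; apply: eq_bigr => p _; rewrite !Normc.normcM.
  move=> p; rewrite inE !negb_and => /or3P[] /Lchi0_eq0 ->;
    by rewrite ?mulr0 ?mul0r ?mulr0 Normc.normc0.
have T2 : \sum_(p in triples t) a p ^+ 2 <= (q.-1)%:R ^+ 2 * (10 ^+ 22 * (1 + harm R B ^+ 3)).
  apply: le_trans (triple_second_moment R q_pr B0 B1 B2 t).
  rewrite pair_bigA /= [leRHS](bigID (fun p => p \in triples t)) /= -[leLHS]addr0 lerD //.
    by rewrite le_eqVlt; apply/orP; left; apply/eqP; apply: eq_bigr => p _; rewrite !exprMn.
  by apply: sumr_ge0 => p _; apply: mulr_ge0; [apply: mulr_ge0|]; exact: sqr_ge0.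
have T3 := le_trans (triple_first_moment q_pr t y1) T1.
have cs := sqr_sum_le (triples t) a.
set n := #|_|%:R in cs *; have n0 : 0 <= n by [].
set N := (q.-1)%:R in T2 T3; have N0 : q%:R / 2 <= N.
  rewrite /N natr_pred //.
  have : 4 <= q%:R :> R by rewrite ler_nat.
  lra.
have NP : 0 < N by apply: lt_le_trans N0; rewrite divr_gt0.
have hH : 1 + harm R B ^+ 3 <= 9 * l ^+ 3.
  have h1 : harm R B <= 2 * l.
    apply: (@le_trans _ _ (1 + ln q%:R)); last by rewrite -/l; lra.
    apply: le_trans (sum_inv_le R q0).
    rewrite /harm [leRHS](@big_cat_nat _ _ _ B) //=; last by rewrite ltnW // ltnS ltnW // (quarter_sqrt_lt B0 B1).
    by rewrite lerDl sumr_ge0 // => k _; rewrite invr_ge0.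
  have h2 : harm R B ^+ 3 <= (2 * l) ^+ 3 by rewrite lerXn2r ?nnegrE ?harm_ge0 //; lra.
  have h3 : 1 <= l ^+ 3 by rewrite exprn_ege1.
  have e : (2 * l) ^+ 3 = 8 * l ^+ 3 by ring.
  lra.
set H := 1 + _ in T2 hH.
have l3 : 0 < l ^+ 3 by rewrite exprn_gt0 //; lra.
have c1 : (N ^+ 2 / 20) ^+ 2 <= n * (N ^+ 2 * (10 ^+ 22 * (9 * l ^+ 3))).
  apply: (@le_trans _ _ ((\sum_(p in triples t) a p) ^+ 2)).
    have n20 : 0 <= N ^+ 2 / 20 by rewrite divr_ge0 ?sqr_ge0.
    by rewrite lerXn2r ?nnegrE // (le_trans n20).
  apply: le_trans cs _; apply: ler_wpM2l => //; apply: le_trans T2 _.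
  apply: ler_wpM2l; first exact: sqr_ge0.
  by apply: ler_wpM2l => //; rewrite exprn_ge0.
have N2 : 0 < N ^+ 2 by rewrite exprn_gt0.
have c2 : N ^+ 2 / 400 <= n * (10 ^+ 22 * (9 * l ^+ 3)).
  rewrite -(ler_pM2r N2); have -> : N ^+ 2 / 400 * N ^+ 2 = (N ^+ 2 / 20) ^+ 2 by field.
  by apply: le_trans c1 _; rewrite le_eqVlt; apply/orP; left; apply/eqP; ring.
have c3 : q%:R ^+ 2 / 4 <= N ^+ 2.
  have -> : q%:R ^+ 2 / 4 = (q%:R / 2) ^+ 2 :> R by field.
  by rewrite lerXn2r ?nnegrE ?(ltW NP) // divr_ge0.
rewrite ler_pdivrMr // mulrC ler_pdivrMr ?exprn_gt0 //.
have n3 : 0 <= n * l ^+ 3 by rewrite mulr_ge0 // ltW.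
have e22 : n * (10 ^+ 22 * (9 * l ^+ 3)) = 9 * 10 ^+ 22 * (n * l ^+ 3) by ring.
rewrite e22 in c2.
have -> : n * l ^+ 3 * 10 ^+ 27 = 10 ^+ 5 * (10 ^+ 22 * (n * l ^+ 3)) by ring.
have n4 : 0 <= 10 ^+ 22 * (n * l ^+ 3) by rewrite mulr_ge0 // exprn_ge0.
have e9 : 9 * 10 ^+ 22 * (n * l ^+ 3) = 9 * (10 ^+ 22 * (n * l ^+ 3)) by ring.
rewrite e9 in c2; move: c2 c3 n4; set X := 10 ^+ 22 * _.
by rewrite !exprS !expr0; lra.
Qed.

Definition cons_fun n (a : I) (u : 'I_n -> I) (i : 'I_n.+1) : I :=
  if unlift ord0 i is Some j then u j else a.

Lemma cons_fun0 n a (u : 'I_n -> I) : cons_fun a u ord0 = a.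
Proof. by rewrite /cons_fun unlift_none. Qed.

Lemma cons_funS n a (u : 'I_n -> I) j : cons_fun a u (lift ord0 j) = u j.
Proof. by rewrite /cons_fun liftK. Qed.

Lemma sum_cons_fun n a (u : 'I_n -> I) :
  \sum_(i < n.+1) cons_fun a u i = a + \sum_(i < n) u i.
Proof.
rewrite big_ord_recl cons_fun0; congr (_ + _).
by apply: eq_bigr => i _; rewrite cons_funS.
Qed.

Lemma cons_fun_all n a (u : 'I_n -> I) (P : I -> Prop) :
  P a -> (forall j, P (u j)) -> forall i, P (cons_fun a u i).
Proof. by move=> Pa Pu i; rewrite /cons_fun; case: unliftP. Qed.

(** The two entries of the pair come first, then the index forced by total sum 0 (that is, trivial
    product), then the [k] free indices. *)
Definition complete_tuple k (d : {ffun 'I_k -> I} * (I * I)) : 'I_k.+3 -> I :=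
  cons_fun d.2.1 (cons_fun d.2.2
    (cons_fun (- (\sum_i d.1 i) - d.2.1 - d.2.2) d.1)).

Lemma sum_complete_tuple k (d : {ffun 'I_k -> I} * (I * I)) : \sum_i complete_tuple d i = 0.
Proof.
rewrite /complete_tuple !sum_cons_fun -(addrA (- _)) (addrC (- _)) subrK.
by rewrite -opprD addrA subrr.
Qed.

Lemma complete_tuple_inj k (d e : {ffun 'I_k -> I} * (I * I)) :
  complete_tuple d =1 complete_tuple e -> d = e.
Proof.
case: d => u [a b]; case: e => v [a' b'] h.
have := h ord0; rewrite /complete_tuple !cons_fun0 /= => ->.
have := h (lift ord0 ord0); rewrite /complete_tuple !cons_funS !cons_fun0 /= => ->.
congr (_, _); apply/ffunP => i.
by have := h (lift ord0 (lift ord0 (lift ord0 i))); rewrite /complete_tuple !cons_funS.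
Qed.

Definition nonvan_family k : {set {ffun 'I_k -> I} * (I * I)} :=
  [set d | (d.1 \in ffun_on (mem nonvan)) && (d.2 \in triples (- \sum_i d.1 i))].

(** The free indices contribute the [k]-th power of a bound with constant 1, so the only constant
    left is that of [triples_card_ge], uniformly in [k]. *)
Lemma card_nonvan_family_ge k : 10 ^+ 4 <= Num.sqrt s ->
  (10 ^+ 27)^-1 * q%:R ^+ k.+2 / ln q%:R ^+ k.+3 <= #|nonvan_family k|%:R :> R.
Proof.
move=> y1; have l1 := one_le_ln y1.
have J := @nonvan_card_ge R q q_pr.
have {}J : q%:R / ln q%:R <= #|nonvan|%:R :> R.
  by apply: J; apply: le_trans y1; rewrite !exprS expr0; lra.
set l := ln _ in l1 J *; have l0 : 0 < l by lra.
have e : #|nonvan_family k| = (\sum_(u in ffun_on (mem nonvan)) #|triples (- \sum_i (u : {ffun 'I_k -> I}) i)|)%N.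
  rewrite -sum1_card (eq_bigl (fun d : {ffun 'I_k -> I} * (I * I) => (d.1 \in ffun_on (mem nonvan)) && (d.2 \in triples (- \sum_i d.1 i)))); last first.
    by move=> d; rewrite inE.
  rewrite -(pair_big_dep (fun u : {ffun 'I_k -> I} => u \in ffun_on (mem nonvan)) (fun u p => p \in triples (- \sum_i u i)) (fun _ _ => 1%N)) /=.
  by apply: eq_bigr => u _; rewrite sum1_card.
rewrite e natr_sum.
apply: (@le_trans _ _ (\sum_(u in ffun_on (mem nonvan) : {pred {ffun 'I_k -> I}}) ((10 ^+ 27)^-1 * q%:R ^+ 2 / l ^+ 3))); last first.
  by apply: ler_sum => u _; exact: triples_card_ge.
rewrite sumr_const card_ffun_on card_ord -[leRHS]mulr_natl natrX.
have c0 : 0 <= (10 ^+ 27)^-1 * q%:R ^+ 2 / l ^+ 3 :> R.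
  by rewrite !mulr_ge0 ?invr_ge0 ?exprn_ge0 // ltW.
have -> : (10 ^+ 27)^-1 * q%:R ^+ k.+2 / l ^+ k.+3 = (q%:R / l) ^+ k * ((10 ^+ 27)^-1 * q%:R ^+ 2 / l ^+ 3).
  have eq : q%:R ^+ k.+2 = q%:R ^+ k * q%:R ^+ 2 :> R by rewrite -exprD addn2.
  have el : l ^+ k.+3 = l ^+ k * l ^+ 3 by rewrite -exprD addn3.
  rewrite eq el expr_div_n; move: (_^-1) => c; field.
  by rewrite expf_neq0 ?lt0r_neq0.
have ql : 0 <= q%:R / l by rewrite divr_ge0 // ltW.
by apply: ler_wpM2r => //; rewrite lerXn2r ?nnegrE.
Qed.

Lemma card_ge_nonvan_family k : 10 ^+ 4 <= Num.sqrt s ->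
  card_ge (fun t => @Wide_star_1 R q k.+3 t /\ forall i, Lhalf (t i) <> 0)
    ((10 ^+ 27)^-1 * (q%:R : R) ^+ k.+2 / ln (q%:R : R) ^+ k.+3).
Proof.
move=> y1; exists #|nonvan_family k|; split; first exact: card_nonvan_family_ge.
(* A default for [nth], never reached below the cardinality. *)
pose d0 : {ffun 'I_k -> I} * (I * I) := ([ffun=> 0], (0, 0)).
pose D i := nth d0 (enum (nonvan_family k)) i.
have DP i : (i < #|nonvan_family k|)%N -> D i \in nonvan_family k.
  by move=> h; rewrite -mem_enum mem_nth // -cardE.
exists (fun n i => chin R (complete_tuple (D n) i)); split.
  move=> n /DP; rewrite inE => /andP[/ffun_onP h1]; rewrite inE => /and3P[h2 h3 h4].
  have all_nv : forall i, complete_tuple (D n) i \in nonvan.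
    by do 3 apply: (@cons_fun_all _ _ _ (fun j => j \in nonvan)) => //.
  have nv j : j \in nonvan -> j != 0 /\ Lhalf (chin R j) <> 0.
    by rewrite inE => /andP[j0 /eqP Lj]; split => //; rewrite Lhalf_chin.
  split; last by move=> i; exact: (nv _ (all_nv i)).2.
  split; first by move=> i; apply: chin_primitive => //; exact: (nv _ (all_nv i)).1.
  by apply: prod_chin => //; exact: sum_complete_tuple.
move=> n l hn hl e; have {}e : D n = D l.
  by apply: complete_tuple_inj => i; apply: (@chin_inj R q q_pr); have := congr1 (fun f => f i) e.
apply/eqP; move/eqP: e; rewrite /D nth_uniq ?enum_uniq // -cardE //.
Qed.

End Counting.

(** * Conclusion for all large primes *)

Local Open Scope classical_set_scope.

Theorem theorem1p3 (R : realType) :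
  exists c : R, 0 < c /\
  forall m : nat -> nat,
    (forall q : nat, (3 <= m q)%N) ->
    (fun q : nat => (m q)%:R / (Num.sqrt (q%:R : R) * ln (q%:R : R))) @ \oo --> 0 ->
    exists Q0 : nat, forall q : nat, prime q -> (Q0 <= q)%N ->
      card_ge
        [set t | @Wide_star_1 R q (m q) t /\ forall i, Lhalf (t i) <> 0]
        (c * (q%:R : R) ^+ (m q).-1 / (ln (q%:R : R)) ^+ (m q)).
Proof.
exists (10 ^+ 27)^-1; split; first by rewrite invr_gt0 exprn_gt0.
move=> m m3 _.
(* This makes [q^(1/4)] at least [10^4], the threshold of the counting lemmas. *)
exists (Num.bound (((10 : R) ^+ 4) ^+ 4)) => q q_pr hq.
have y1 : (10 : R) ^+ 4 <= Num.sqrt (Num.sqrt q%:R).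
  have c0 : 0 <= (10 : R) ^+ 4 by rewrite exprn_ge0.
  rewrite -ler_sqr ?nnegrE ?sqrtr_ge0 // sqr_sqrtr ?sqrtr_ge0 //.
  rewrite -ler_sqr ?nnegrE ?sqrtr_ge0 ?sqr_ge0 // sqr_sqrtr // -exprM.
  apply: le_trans (ltW (archi_boundP _)) _; first by rewrite exprn_ge0.
  by rewrite ler_nat.
have := m3 q; case: (m q) => [|[|[|k]]] // _.
exact: card_ge_nonvan_family.
Qed.
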